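(* Let $n\ge0$ be an integer and $\mathscr{C}$ an $n$-Frobenius category. Let $M,N$ be arbitrary objects of $\mathscr{C}$ and let $\delta_N\in\mathrm{Ext}^n_{\mathscr{C}}(N,\Omega^nN)$ be a unit extension. Then the correspondence $$\Psi:\mathrm{Ext}^n_{\mathscr{C}}(M,\Omega^nN)\longrightarrow\mathrm{Nat}\big(\mathrm{Ext}^{n+1}_{\mathscr{C}}(N,-),\mathrm{Ext}^{n+1}_{\mathscr{C}}(M,-)\big),\qquad\gamma\mapsto\Psi_\gamma,$$ with $\Psi_\gamma$ as defined in the context, induces an isomorphism $$\mathrm{Ext}^n_{\mathscr{C}}(M,\Omega^nN)/\mathcal{P}\;\xrightarrow{\ \cong\ }\;\mathrm{Nat}\big(\mathrm{Ext}^{n+1}_{\mathscr{C}}(N,-),\mathrm{Ext}^{n+1}_{\mathscr{C}}(M,-)\big).$$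
   Context: $\mathscr{C}$ is an extension-closed full additive subcategory of an abelian category, regarded as an exact category with conflations the short exact sequences with all terms in $\mathscr{C}$. $\mathrm{Ext}^t_{\mathscr{C}}(B,A)$ is the Yoneda Ext group (classes of extensions of length $t$, i.e. splices of $t$ conflations, from $A$ on the left to $B$ on the right, modulo the equivalence relation generated by morphisms of extensions that are the identity on both ends, ''morphisms with fixed ends''; Baer sum), with $\mathrm{Ext}^0_{\mathscr{C}}=\mathrm{Hom}_{\mathscr{C}}$. For $\eta\in\mathrm{Ext}^t_{\mathscr{C}}(B,A)$, $\eta'\in\mathrm{Ext}^{t'}_{\mathscr{C}}(C,B)$, $\eta\eta'\in\mathrm{Ext}^{t+t'}_{\mathscr{C}}(C,A)$ is the Yoneda product (push-out if $t=0$, pull-back if $t'=0$). An object $P$ (resp. $I$) is $n$-projective (resp. $n$-injective) if $\mathrm{Ext}^i_{\mathscr{C}}(P,X)=0$ (resp. $\mathrm{Ext}^i_{\mathscr{C}}(X,I)=0$) for all $i>n$ and all $X\in\mathscr{C}$. $\mathscr{C}$ is $n$-Frobenius if it has enough $n$-projectives and enough $n$-injectives and these two classes coincide. A unit extension (syzygy sequence) of length $t\ge1$ ending at $N$ is an extension $\Omega^tN\to P_{t-1}\to\cdots\to P_0\to N$ with all $P_i$ $n$-projective; for $t=0$, $\Omega^0N=N$ and it is $1_N$. $\mathcal{P}\subseteq\mathrm{Ext}^n_{\mathscr{C}}(X,Y)$ is the subgroup of elements $f\beta$ with $f:P\to Y$ a morphism, $P$ $n$-projective and $\beta\in\mathrm{Ext}^n_{\mathscr{C}}(X,P)$.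 For unit extensions $\delta_N\in\mathrm{Ext}^n_{\mathscr{C}}(N,\Omega^nN)$, $\delta'_N\in\mathrm{Ext}^n_{\mathscr{C}}(N,\Omega'^nN)$ there exist inflations $a:\Omega^nN\to\Omega''^nN$, $b:\Omega'^nN\to\Omega''^nN$ with $n$-projective cokernels such that $a\delta_N=b\delta'_N$; such a pair is called an angled pair. For any such $b$ and any $M$, the map $\mathrm{Ext}^n_{\mathscr{C}}(M,\Omega'^nN)/\mathcal{P}\to\mathrm{Ext}^n_{\mathscr{C}}(M,\Omega''^nN)/\mathcal{P}$ induced by $b$ is an isomorphism; $b^{-1}a\gamma$ denotes any $\gamma'\in\mathrm{Ext}^n_{\mathscr{C}}(M,\Omega'^nN)$ with $a\gamma-b\gamma'\in\mathcal{P}$. Definition of $\Psi_\gamma$: given $\gamma\in\mathrm{Ext}^n_{\mathscr{C}}(M,\Omega^nN)$, $T\in\mathscr{C}$ and $\alpha\in\mathrm{Ext}^{n+1}_{\mathscr{C}}(N,T)$, choose a unit extension $\delta'_N\in\mathrm{Ext}^n_{\mathscr{C}}(N,\Omega'^nN)$ and $\alpha_1\in\mathrm{Ext}^1_{\mathscr{C}}(\Omega'^nN,T)$ with a morphism of extensions $\alpha_1\delta'_N\to\alpha$ with fixed ends, choose an angled pair $a,b$ for $\delta_N,\delta'_N$, and set $\Psi_\gamma(T)(\alpha)=\alpha_1\gamma'$ with $\gamma'=b^{-1}a\gamma$. This is independent of the choices and $\Psi_\gamma$ is a natural transformation. $\mathrm{Nat}$ denotes the group of natural transformations of functors to abelian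 groups. *)

(* Defs.v *)
From HB Require Import structures.
From mathcomp Require Import all_boot all_order all_algebra.
From mathcomp Require Import boolp.
From Stdlib Require Import Relation_Operators.

Set Implicit Arguments.
Unset Strict Implicit.
Unset Printing Implicit Defensive.

Import GRing.Theory.
Local Open Scope ring_scope.
Local Open Scope quotient_scope.

Declare Scope cat_scope.
Delimit Scope cat_scope with cat.
Local Open Scope cat_scope.

Record preadd := Preadd {
  obj :> Type;
  hom : obj -> obj -> zmodType;
  idm : forall X, hom X X;
  comp : forall X Y Z, hom Y Z -> hom X Y -> hom X Z;
  compA : forall X Y Z W (h : hom Z W) (g : hom Y Z) (f : hom X Y),
    comp h (comp g f) = comp (comp h g) f;
  comp1m : forall X Y (f : hom X Y), comp (idm Y) f = f;
  compm1 : forall X Y (f : hom X Y), comp f (idm X) = f;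
  compDl : forall X Y Z (g g' : hom Y Z) (f : hom X Y),
    comp (g + g') f = comp g f + comp g' f;
  compDr : forall X Y Z (g : hom Y Z) (f f' : hom X Y),
    comp g (f + f') = comp g f + comp g f' }.

Arguments hom {_} _ _.
Arguments idm {_} _.
Arguments comp {_ _ _ _} _ _.

Notation "g ∘ f" := (comp g f) (at level 40, left associativity) : cat_scope.

Section Limits.
Variable A : preadd.
Implicit Types X Y Z K Q : A.

Definition is_mono X Y (i : hom X Y) :=
  forall Z (u v : hom Z X), i ∘ u = i ∘ v -> u = v.

Definition is_epi X Y (p : hom X Y) :=
  forall Z (u v : hom Y Z), u ∘ p = v ∘ p -> u = v.

Definition is_kernel X Y K (f : hom X Y) (k : hom K X) :=
  f ∘ k = 0 /\ forall Z (u : hom Z X), f ∘ u = 0 -> exists! v : hom Z K, k ∘ v = u.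

Definition is_cokernel X Y Q (f : hom X Y) (q : hom Y Q) :=
  q ∘ f = 0 /\ forall Z (u : hom Y Z), u ∘ f = 0 -> exists! v : hom Q Z, v ∘ q = u.

Definition short_exact X Y Z (i : hom X Y) (p : hom Y Z) :=
  is_kernel p i /\ is_cokernel i p.

Record biproduct X Y := Biproduct {
  bip :> A;
  inl_ : hom X bip;
  inr_ : hom Y bip;
  prl : hom bip X;
  prr : hom bip Y;
  prl_inl : prl ∘ inl_ = idm X;
  prr_inr : prr ∘ inr_ = idm Y;
  prl_inr : prl ∘ inr_ = 0;
  prr_inl : prr ∘ inl_ = 0;
  bip_id : inl_ ∘ prl + inr_ ∘ prr = idm bip }.

End Limits.

Record abelian := Abelian {
  ab_cat :> preadd;
  ob0 : ab_cat;
  ob0_init : forall (X : ab_cat) (f : hom ob0 X), f = 0;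
  ob0_term : forall (X : ab_cat) (f : hom X ob0), f = 0;
  dsum : forall X Y : ab_cat, biproduct X Y;
  has_kernel : forall (X Y : ab_cat) (f : hom X Y),
    exists (K : ab_cat) (k : hom K X), is_kernel f k;
  has_cokernel : forall (X Y : ab_cat) (f : hom X Y),
    exists (Q : ab_cat) (q : hom Y Q), is_cokernel f q;
  mono_normal : forall (X Y : ab_cat) (i : hom X Y), is_mono i ->
    exists (Z : ab_cat) (f : hom Y Z), is_kernel f i;
  epi_normal : forall (X Y : ab_cat) (p : hom X Y), is_epi p ->
    exists (Z : ab_cat) (f : hom Z X), is_cokernel f p }.

Record ext_closed (A : abelian) := ExtClosed {
  ex_mem : A -> Prop;
  ex_mem0 : ex_mem (ob0 A);
  ex_memD : forall X Y : A, ex_mem X -> ex_mem Y -> ex_mem (dsum X Y);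
  ex_ext : forall (X Y Z : A) (i : hom X Y) (p : hom Y Z),
    short_exact i p -> ex_mem X -> ex_mem Z -> ex_mem Y }.

(* Objects of the full subcategory; its morphisms are those of [A]. *)
Record ex_obj (A : abelian) (C : ext_closed A) : Type := ExObj {
  ex_val :> A;
  ex_valP : ex_mem C ex_val }.

Coercion ex_obj : ext_closed >-> Sortclass.

Section PreaddTheory.
Variable A : preadd.
Implicit Types X Y Z W : A.

Lemma comp0m X Y Z (f : hom X Y) : (0 : hom Y Z) ∘ f = 0.
Proof. by apply: (addrI (0 ∘ f)); rewrite -compDl !addr0. Qed.

Lemma compm0 X Y Z (g : hom Y Z) : g ∘ (0 : hom X Y) = 0.
Proof. by apply: (addrI (g ∘ 0)); rewrite -compDr !addr0. Qed.

Lemma compNl X Y Z (g : hom Y Z) (f : hom X Y) : (- g) ∘ f = - (g ∘ f).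
Proof. by apply: (addrI (g ∘ f)); rewrite -compDl !subrr comp0m. Qed.

Lemma compNr X Y Z (g : hom Y Z) (f : hom X Y) : g ∘ (- f) = - (g ∘ f).
Proof. by apply: (addrI (g ∘ f)); rewrite -compDr !subrr compm0. Qed.

Lemma kernel_mono X Y K (f : hom X Y) (k : hom K X) : is_kernel f k -> is_mono k.
Proof.
move=> [fk0 U] Z u v kuv.
have [|w [_ Uw]] := U Z (k ∘ v); first by rewrite compA fk0 comp0m.
by rewrite -(Uw u) ?(Uw v).
Qed.

Lemma cokernel_epi X Y Q (f : hom X Y) (q : hom Y Q) : is_cokernel f q -> is_epi q.
Proof.
move=> [qf0 U] Z u v uvq.
have [|w [_ Uw]] := U Z (v ∘ q); first by rewrite -compA qf0 compm0.
by rewrite -(Uw u) ?(Uw v).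
Qed.

Lemma kernelP X Y K (f : hom X Y) (k : hom K X) :
    f ∘ k = 0 -> is_mono k ->
    (forall Z (u : hom Z X), f ∘ u = 0 -> exists v : hom Z K, k ∘ v = u) ->
  is_kernel f k.
Proof.
move=> fk0 mk U; split=> // Z u /U[v kv]; exists v; split=> // w kw.
by apply: mk; rewrite kv.
Qed.

Lemma cokernelP X Y Q (f : hom X Y) (q : hom Y Q) :
    q ∘ f = 0 -> is_epi q ->
    (forall Z (u : hom Y Z), u ∘ f = 0 -> exists v : hom Q Z, v ∘ q = u) ->
  is_cokernel f q.
Proof.
move=> fk0 mk U; split=> // Z u /U[v kv]; exists v; split=> // w kw.
by apply: mk; rewrite kv.
Qed.

Lemma mono0 X Y (i : hom X Y) :
  (forall Z (u : hom Z X), i ∘ u = 0 -> u = 0) -> is_mono i.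
Proof.
move=> i0 Z u v iuv; apply/eqP; rewrite -subr_eq0; apply/eqP/i0.
by rewrite compDr compNr iuv subrr.
Qed.

Lemma epi0 X Y (p : hom X Y) :
  (forall Z (u : hom Y Z), u ∘ p = 0 -> u = 0) -> is_epi p.
Proof.
move=> p0 Z u v uvp; apply/eqP; rewrite -subr_eq0; apply/eqP/p0.
by rewrite compDl compNl uvp subrr.
Qed.

End PreaddTheory.

Section AbelianTheory.
Variable A : abelian.
Implicit Types X Y Z W : A.

Lemma mono_ses X Y Z (i : hom X Y) (p : hom Y Z) :
  is_mono i -> is_cokernel i p -> short_exact i p.
Proof.
move=> mi cp; split=> //.
have [W [g [gi0 U]]] := mono_normal mi.
apply: kernelP => //; first exact: cp.1.
move=> V u pu0; have [g' [g'p _]] := cp.2 _ g gi0.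
have [|v [iv _]] := U _ u; last by exists v.
by rewrite -g'p -compA pu0 compm0.
Qed.

Lemma epi_ses X Y Z (i : hom X Y) (p : hom Y Z) :
  is_epi p -> is_kernel p i -> short_exact i p.
Proof.
move=> mp ki; split=> //.
have [W [g [pg0 U]]] := epi_normal mp.
apply: cokernelP => //; first exact: ki.1.
move=> V u ui0; have [g' [ig' _]] := ki.2 _ g pg0.
have [|v [iv _]] := U _ u; last by exists v.
by rewrite -ig' compA ui0 comp0m.
Qed.

Definition copair X Y Z (f : hom X Z) (g : hom Y Z) : hom (dsum X Y) Z :=
  f ∘ prl (dsum X Y) + g ∘ prr (dsum X Y).

Definition pair_ X Y Z (f : hom Z X) (g : hom Z Y) : hom Z (dsum X Y) :=
  inl_ (dsum X Y) ∘ f + inr_ (dsum X Y) ∘ g.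

Definition dmap X Y X' Y' (f : hom X X') (g : hom Y Y') :
  hom (dsum X Y) (dsum X' Y') :=
  pair_ (f ∘ prl (dsum X Y)) (g ∘ prr (dsum X Y)).

Definition diagm X : hom X (dsum X X) := pair_ (idm X) (idm X).
Definition codiagm X : hom (dsum X X) X := copair (idm X) (idm X).

Lemma prl_pair X Y Z (f : hom Z X) (g : hom Z Y) : prl (dsum X Y) ∘ pair_ f g = f.
Proof. by rewrite /pair_ compDr !compA prl_inl prl_inr comp1m comp0m addr0. Qed.

Lemma prr_pair X Y Z (f : hom Z X) (g : hom Z Y) : prr (dsum X Y) ∘ pair_ f g = g.
Proof. by rewrite /pair_ compDr !compA prr_inl prr_inr comp1m comp0m add0r. Qed.

Lemma copair_inl X Y Z (f : hom X Z) (g : hom Y Z) : copair f g ∘ inl_ (dsum X Y) = f.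
Proof. by rewrite /copair compDl -!compA prl_inl prr_inl compm1 compm0 addr0. Qed.

Lemma copair_inr X Y Z (f : hom X Z) (g : hom Y Z) : copair f g ∘ inr_ (dsum X Y) = g.
Proof. by rewrite /copair compDl -!compA prl_inr prr_inr compm1 compm0 add0r. Qed.

Lemma pair_comp X Y Z W (f : hom Z X) (g : hom Z Y) (h : hom W Z) :
  pair_ f g ∘ h = pair_ (f ∘ h) (g ∘ h).
Proof. by rewrite /pair_ compDl -!compA. Qed.

Lemma comp_copair X Y Z W (f : hom X Z) (g : hom Y Z) (h : hom Z W) :
  h ∘ copair f g = copair (h ∘ f) (h ∘ g).
Proof. by rewrite /copair compDr !compA. Qed.

Lemma copair_pair X Y Z W (f : hom X Z) (g : hom Y Z) (f' : hom W X) (g' : hom W Y) :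
  copair f g ∘ pair_ f' g' = f ∘ f' + g ∘ g'.
Proof. by rewrite /copair compDl -!compA prl_pair prr_pair. Qed.

Lemma dmap_pair X Y X' Y' Z (f : hom X X') (g : hom Y Y') (f' : hom Z X) (g' : hom Z Y) :
  dmap f g ∘ pair_ f' g' = pair_ (f ∘ f') (g ∘ g').
Proof. by rewrite /dmap pair_comp -!compA prl_pair prr_pair. Qed.

Lemma copair_dmap X Y X' Y' Z (f : hom X X') (g : hom Y Y') (f' : hom X' Z) (g' : hom Y' Z) :
  copair f' g' ∘ dmap f g = copair (f' ∘ f) (g' ∘ g).
Proof. by rewrite /dmap copair_pair /copair !compA. Qed.

Lemma dmap_comp X Y X' Y' X'' Y'' (f : hom X X') (g : hom Y Y')
    (f' : hom X' X'') (g' : hom Y' Y'') :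
  dmap f' g' ∘ dmap f g = dmap (f' ∘ f) (g' ∘ g).
Proof. by rewrite {2}/dmap dmap_pair !compA. Qed.

Lemma dmap1 X Y : dmap (idm X) (idm Y) = idm (dsum X Y).
Proof. by rewrite /dmap /pair_ !comp1m bip_id. Qed.

Lemma pair_ext X Y Z (f g : hom Z (dsum X Y)) :
  prl (dsum X Y) ∘ f = prl (dsum X Y) ∘ g ->
  prr (dsum X Y) ∘ f = prr (dsum X Y) ∘ g -> f = g.
Proof.
by move=> fl fr; rewrite -[f]comp1m -[g]comp1m -!bip_id !compDl -!compA fl fr.
Qed.

Lemma copair_ext X Y Z (f g : hom (dsum X Y) Z) :
  f ∘ inl_ (dsum X Y) = g ∘ inl_ (dsum X Y) ->
  f ∘ inr_ (dsum X Y) = g ∘ inr_ (dsum X Y) -> f = g.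
Proof.
by move=> fl fr; rewrite -[f]compm1 -[g]compm1 -!bip_id !compDr !compA fl fr.
Qed.

Lemma dmap_ses X Y Z X' Y' Z' (i : hom X Y) (p : hom Y Z) (i' : hom X' Y') (p' : hom Y' Z') :
  short_exact i p -> short_exact i' p' -> short_exact (dmap i i') (dmap p p').
Proof.
move=> [k c] [k' c']; split.
- apply: kernelP.
  + rewrite dmap_comp k.1 k'.1; apply: pair_ext; rewrite compm0 /dmap ?prl_pair ?prr_pair;
    exact: comp0m.
  + apply: mono0 => W u.
    rewrite /dmap pair_comp => E.
    have E1 : i ∘ (prl (dsum X X') ∘ u) = 0.
      by rewrite compA -(prl_pair (i ∘ prl (dsum X X') ∘ u) (i' ∘ prr (dsum X X') ∘ u)) E compm0.
    have E2 : i' ∘ (prr (dsum X X') ∘ u) = 0.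
      by rewrite compA -(prr_pair (i ∘ prl (dsum X X') ∘ u) (i' ∘ prr (dsum X X') ∘ u)) E compm0.
    apply: pair_ext; rewrite compm0.
      by apply: (kernel_mono k); rewrite E1 compm0.
    by apply: (kernel_mono k'); rewrite E2 compm0.
  + move=> W u E; have /k.2[v [Ev _]] : p ∘ (prl (dsum Y Y') ∘ u) = 0.
      rewrite compA -(prl_pair (p ∘ prl (dsum Y Y')) (p' ∘ prr (dsum Y Y'))).
      by rewrite -[pair_ _ _]/(dmap p p') -compA E compm0.
    have /k'.2[v' [Ev' _]] : p' ∘ (prr (dsum Y Y') ∘ u) = 0.
      rewrite compA -(prr_pair (p ∘ prl (dsum Y Y')) (p' ∘ prr (dsum Y Y'))).
      by rewrite -[pair_ _ _]/(dmap p p') -compA E compm0.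
    exists (pair_ v v'); rewrite dmap_pair Ev Ev'.
    by apply: pair_ext; rewrite ?prl_pair ?prr_pair.
- have dE (V V' V1 V1' : A) (f : hom V V1) (g : hom V' V1') :
    dmap f g = copair (inl_ (dsum V1 V1') ∘ f) (inr_ (dsum V1 V1') ∘ g).
    by rewrite /dmap /pair_ /copair !compA.
  apply: cokernelP.
  + rewrite dmap_comp k.1 k'.1; apply: pair_ext; rewrite compm0 /dmap ?prl_pair ?prr_pair;
    exact: comp0m.
  + apply: epi0 => W u; rewrite dE comp_copair !compA => E.
    have E1 := congr1 (fun h => h ∘ inl_ (dsum Y Y')) E.
    have E2 := congr1 (fun h => h ∘ inr_ (dsum Y Y')) E.
    rewrite /= comp0m copair_inl in E1; rewrite /= comp0m copair_inr in E2.
    apply: copair_ext; rewrite comp0m.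
      by apply: (cokernel_epi c); rewrite E1 comp0m.
    by apply: (cokernel_epi c'); rewrite E2 comp0m.
  + move=> W u E; have E1 := congr1 (fun h => h ∘ inl_ (dsum X X')) E.
    have E2 := congr1 (fun h => h ∘ inr_ (dsum X X')) E.
    rewrite /= comp0m -compA dE copair_inl compA in E1.
    rewrite /= comp0m -compA dE copair_inr compA in E2.
    have [v [Ev _]] := c.2 _ _ E1; have [v' [Ev' _]] := c'.2 _ _ E2.
    exists (copair v v'); rewrite copair_dmap Ev Ev'.
    by apply: copair_ext; rewrite ?copair_inl ?copair_inr.
Qed.

Record pushout_of X Y Z X' (i : hom X Y) (p : hom Y Z) (f : hom X X') := PushoutOf {
  po_obj : A;
  po_inf : hom X' po_obj;
  po_def : hom po_obj Z;
  po_map : hom Y po_obj;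
  po_ses : short_exact po_inf po_def;
  po_sq : po_map ∘ i = po_inf ∘ f;
  po_defE : po_def ∘ po_map = p;
  po_univ : forall W (h : hom Y W) (h' : hom X' W), h ∘ i = h' ∘ f ->
    exists2 v : hom po_obj W, v ∘ po_map = h & v ∘ po_inf = h';
  po_ext : forall W (u v : hom po_obj W),
    u ∘ po_map = v ∘ po_map -> u ∘ po_inf = v ∘ po_inf -> u = v }.

Record pullback_of X Y Z Z' (i : hom X Y) (p : hom Y Z) (g : hom Z' Z) := PullbackOf {
  pb_obj : A;
  pb_inf : hom X pb_obj;
  pb_def : hom pb_obj Z';
  pb_map : hom pb_obj Y;
  pb_ses : short_exact pb_inf pb_def;
  pb_sq : p ∘ pb_map = g ∘ pb_def;
  pb_infE : pb_map ∘ pb_inf = i;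
  pb_univ : forall W (h : hom W Y) (h' : hom W Z'), p ∘ h = g ∘ h' ->
    exists2 v : hom W pb_obj, pb_map ∘ v = h & pb_def ∘ v = h';
  pb_ext : forall W (u v : hom W pb_obj),
    pb_map ∘ u = pb_map ∘ v -> pb_def ∘ u = pb_def ∘ v -> u = v }.

Lemma pushout_ex X Y Z X' (i : hom X Y) (p : hom Y Z) (f : hom X X') :
  short_exact i p -> inhabited (pushout_of i p f).
Proof.
move=> [ki cp]; have [Q [q cq]] := has_cokernel (pair_ i (- f)).
set D := dsum Y X' in q cq *.
have qE : q = copair (q ∘ inl_ D) (q ∘ inr_ D).
  by apply: copair_ext; rewrite ?copair_inl ?copair_inr.
have sq : q ∘ inl_ D ∘ i = q ∘ inr_ D ∘ f.
  by apply/eqP; rewrite -subr_eq0 -compNr -copair_pair -qE cq.1.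
have univ W (h : hom Y W) (h' : hom X' W) : h ∘ i = h' ∘ f ->
    exists2 v : hom Q W, v ∘ (q ∘ inl_ D) = h & v ∘ (q ∘ inr_ D) = h'.
  move=> E; have [|v [Ev _]] := cq.2 _ (copair h h').
    by rewrite copair_pair compNr E subrr.
  by exists v; rewrite compA Ev ?copair_inl ?copair_inr.
have ext W (u v : hom Q W) : u ∘ (q ∘ inl_ D) = v ∘ (q ∘ inl_ D) ->
    u ∘ (q ∘ inr_ D) = v ∘ (q ∘ inr_ D) -> u = v.
  by move=> E1 E2; apply: (cokernel_epi cq); apply: copair_ext; rewrite -!compA.
have /cid2[d d1 d2] : exists2 d : hom Q Z, d ∘ (q ∘ inl_ D) = p & d ∘ (q ∘ inr_ D) = 0.
  by apply: univ; rewrite comp0m; exact: ki.1.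
constructor; exists Q (q ∘ inr_ D) d (q ∘ inl_ D) => //; apply: mono_ses.
  apply: mono0 => W z qz0.
  have km : is_mono (pair_ i (- f)).
    apply: mono0 => V u /(congr1 (comp (prl D))); rewrite compA prl_pair compm0 => iu.
    by apply: (kernel_mono ki); rewrite iu compm0.
  have [ku _] := mono_ses km cq.
  have [|w [Ew _]] := ku.2 _ (inr_ D ∘ z); first by rewrite compA.
  have w0 : w = 0.
    apply: (kernel_mono ki); move/(congr1 (comp (prl D))): Ew.
    by rewrite !compA prl_pair prl_inr comp0m compm0.
  move/(congr1 (comp (prr D))): Ew.
  by rewrite w0 !compA prr_inr comp1m compm0.
apply: cokernelP => //.
  apply: epi0 => W u ud0; apply: (cokernel_epi cp).
  by rewrite -d1 compA ud0 !comp0m.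
move=> W x x0.
have [|y [Ey _]] := cp.2 _ (x ∘ (q ∘ inl_ D)).
  by rewrite -compA sq compA x0 comp0m.
by exists y; apply: ext; rewrite -compA ?d1 ?d2 ?compm0.
Qed.

Lemma pullback_ex X Y Z Z' (i : hom X Y) (p : hom Y Z) (g : hom Z' Z) :
  short_exact i p -> inhabited (pullback_of i p g).
Proof.
move=> [ki cp]; have [Q [q cq]] := has_kernel (copair p (- g)).
set D := dsum Y Z' in q cq *.
have qE : q = pair_ (prl D ∘ q) (prr D ∘ q).
  by apply: pair_ext; rewrite ?prl_pair ?prr_pair.
have sq : p ∘ (prl D ∘ q) = g ∘ (prr D ∘ q).
  by apply/eqP; rewrite -subr_eq0 -compNl -copair_pair -qE cq.1.
have univ W (h : hom W Y) (h' : hom W Z') : p ∘ h = g ∘ h' ->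
    exists2 v : hom W Q, (prl D ∘ q) ∘ v = h & (prr D ∘ q) ∘ v = h'.
  move=> E; have [|v [Ev _]] := cq.2 _ (pair_ h h').
    by rewrite copair_pair compNl E subrr.
  by exists v; rewrite -compA Ev ?prl_pair ?prr_pair.
have ext W (u v : hom W Q) : (prl D ∘ q) ∘ u = (prl D ∘ q) ∘ v ->
    (prr D ∘ q) ∘ u = (prr D ∘ q) ∘ v -> u = v.
  by move=> E1 E2; apply: (kernel_mono cq); apply: pair_ext; rewrite !compA.
have /cid2[d d1 d2] : exists2 d : hom X Q, (prl D ∘ q) ∘ d = i & (prr D ∘ q) ∘ d = 0.
  by apply: univ; rewrite compm0; exact: ki.1.
constructor; exists Q d (prr D ∘ q) (prl D ∘ q) => //; apply: epi_ses.
  apply: epi0 => W z qz0.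
  have ke : is_epi (copair p (- g)).
    apply: epi0 => V u /(congr1 (fun h => h ∘ inl_ D)) /=.
    rewrite -compA copair_inl comp0m => iu.
    by apply: (cokernel_epi cp); rewrite iu comp0m.
  have [_ ku] := epi_ses ke cq.
  have [|w [Ew _]] := ku.2 _ (z ∘ prr D); first by rewrite -compA.
  have w0 : w = 0.
    apply: (cokernel_epi cp); move/(congr1 (fun h => h ∘ inl_ D)): Ew.
    by rewrite /= -!compA copair_inl prr_inl comp0m compm0.
  move/(congr1 (fun h => h ∘ inr_ D)): Ew.
  by rewrite /= w0 -!compA prr_inr compm1 comp0m.
apply: kernelP => //.
  apply: mono0 => W u ud0; apply: (kernel_mono ki).
  by rewrite -d1 -compA ud0 !compm0.
move=> W x x0.
have [|y [Ey _]] := ki.2 _ ((prl D ∘ q) ∘ x).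
  by rewrite compA sq -compA x0 compm0.
by exists y; apply: ext; rewrite compA ?d1 ?d2 ?comp0m.
Qed.

Definition pushout X Y Z X' (i : hom X Y) (p : hom Y Z) (f : hom X X')
    (h : short_exact i p) : pushout_of i p f :=
  projT1 (cid (let: inhabits x := pushout_ex f h in ex_intro (fun=> True) x I)).

Definition pullback X Y Z Z' (i : hom X Y) (p : hom Y Z) (g : hom Z' Z)
    (h : short_exact i p) : pullback_of i p g :=
  projT1 (cid (let: inhabits x := pullback_ex g h in ex_intro (fun=> True) x I)).

End AbelianTheory.

Section Extensions.
Variables (A : abelian) (C : ext_closed A).
Implicit Types X Y Z B K : C.

Record conflation (B K : C) := Conflation {
  mid : C;
  infl : hom K mid;
  defl : hom mid B;
  conf_ses : short_exact infl defl }.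

Definition conf_push B K K' (f : hom K K') (c : conflation B K) : conflation B K' :=
  let po := pushout f (conf_ses c) in
  @Conflation B K' (ExObj (ex_ext (po_ses po) (ex_valP K') (ex_valP B)))
    (po_inf po) (po_def po) (po_ses po).

Definition conf_pull B B' K (g : hom B' B) (c : conflation B K) : conflation B' K :=
  let pb := pullback g (conf_ses c) in
  @Conflation B' K (ExObj (ex_ext (pb_ses pb) (ex_valP K) (ex_valP B')))
    (pb_inf pb) (pb_def pb) (pb_ses pb).

Definition ex_dsum X Y : C := ExObj (ex_memD (ex_valP X) (ex_valP Y)).
Definition ex_ob0 : C := ExObj (ex_mem0 C).

Definition conf_sum B K B' K' (c : conflation B K) (c' : conflation B' K') :
    conflation (ex_dsum B B') (ex_dsum K K') :=
  @Conflation (ex_dsum B B') (ex_dsum K K') (ex_dsum (mid c) (mid c'))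
    (dmap (infl c) (infl c')) (dmap (defl c) (defl c'))
    (dmap_ses (conf_ses c) (conf_ses c')).

Lemma split_ses B K : short_exact (inl_ (dsum K B)) (prr (dsum K B)).
Proof.
split.
  apply: kernelP; first exact: prr_inl.
    move=> Z u v /(congr1 (comp (prl (dsum K B)))).
    by rewrite !compA prl_inl !comp1m.
  move=> Z u u0; exists (prl (dsum K B) ∘ u).
  by rewrite -[RHS]comp1m -bip_id compDl -!compA u0 compm0 addr0.
apply: cokernelP; first exact: prr_inl.
  move=> Z u v /(congr1 (fun h => h ∘ inr_ (dsum K B))) /=.
  by rewrite -!compA prr_inr !compm1.
move=> Z u u0; exists (u ∘ inr_ (dsum K B)).
by rewrite -[RHS]compm1 -bip_id compDr !compA u0 comp0m add0r.
Qed.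

Definition conf_split B K : conflation B K :=
  @Conflation B K (ex_dsum K B) _ _ (split_ses B K).

Lemma id0_ses K : short_exact (idm K) (0 : hom K ex_ob0).
Proof.
split.
  apply: kernelP; first by rewrite comp0m.
    by move=> Z u v; rewrite !comp1m.
  by move=> Z u _; exists u; rewrite comp1m.
apply: cokernelP; first by rewrite comp0m.
  by move=> Z u v _; rewrite [u]ob0_init [v]ob0_init.
by move=> Z u; rewrite compm1 => ->; exists 0; rewrite comp0m.
Qed.

Definition conf_id0 K : conflation ex_ob0 K := @Conflation ex_ob0 K K _ _ (id0_ses K).

(* [yseq s B K] is the type of extensions of length [s.+1]
   [K -> E_s -> ... -> E_0 -> B], presented as a splice of [s.+1] conflations
   listed from the left. *)
Fixpoint yseq (s : nat) (B K : C) : Type :=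
  match s with
  | 0 => conflation B K
  | s'.+1 => {L : C & conflation L K * yseq s' B L}%type
  end.

Definition splice B K L s (c : conflation L K) (e : yseq s B L) : yseq s.+1 B K :=
  existT _ L (c, e).

Fixpoint all_mid (P : C -> Prop) s (B K : C) : yseq s B K -> Prop :=
  match s with
  | 0 => fun c => P (mid c)
  | s'.+1 => fun e => P (mid (projT2 e).1) /\ all_mid P (projT2 e).2
  end.

Definition conf_mor B K B' K' (c : conflation B K) (c' : conflation B' K')
    (f : hom K K') (g : hom B B') : Prop :=
  exists h : hom (mid c) (mid c'),
    h ∘ infl c = infl c' ∘ f /\ g ∘ defl c = defl c' ∘ h.

(* [ymor e e' f g]: there is a morphism of extensions from [e] to [e'] with
   left end [f] and right end [g]. *)
Fixpoint ymor s (B K B' K' : C) :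
    yseq s B K -> yseq s B' K' -> hom K K' -> hom B B' -> Prop :=
  match s with
  | 0 => fun c c' f g => conf_mor c c' f g
  | s'.+1 => fun e e' f g => exists k : hom (projT1 e) (projT1 e'),
      conf_mor (projT2 e).1 (projT2 e').1 f k /\ ymor (projT2 e).2 (projT2 e').2 k g
  end.

Definition fixed_ends s B K (e e' : yseq s B K) : Prop := ymor e e' (idm K) (idm B).

Definition yeqv s B K : yseq s B K -> yseq s B K -> Prop :=
  clos_refl_sym_trans _ (@fixed_ends s B K).

Definition ypush s B K K' (f : hom K K') : yseq s B K -> yseq s B K' :=
  match s with
  | 0 => fun c => conf_push f c
  | s'.+1 => fun e => splice (conf_push f (projT2 e).1) (projT2 e).2
  end.

Fixpoint ypull s B B' K (g : hom B' B) : yseq s B K -> yseq s B' K :=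
  match s with
  | 0 => fun c => conf_pull g c
  | s'.+1 => fun e => splice (projT2 e).1 (ypull g (projT2 e).2)
  end.

Fixpoint ysum s (B K B' K' : C) :
    yseq s B K -> yseq s B' K' -> yseq s (ex_dsum B B') (ex_dsum K K') :=
  match s with
  | 0 => fun c c' => conf_sum c c'
  | s'.+1 => fun e e' =>
      splice (conf_sum (projT2 e).1 (projT2 e').1) (ysum (projT2 e).2 (projT2 e').2)
  end.

Definition ybaer s B K (e e' : yseq s B K) : yseq s B K :=
  @ypush s B (ex_dsum K K) K (codiagm K)
    (@ypull s (ex_dsum B B) B (ex_dsum K K) (diagm B) (ysum e e')).

Fixpoint yzero s (B K : C) : yseq s B K :=
  match s with
  | 0 => conf_split B K
  | s'.+1 => splice (conf_id0 K) (yzero s' B ex_ob0)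
  end.

Definition yopp s B K (e : yseq s B K) : yseq s B K := ypush (- idm K) e.

Lemma conf_mor_comp B K B' K' B'' K'' (c : conflation B K) (c' : conflation B' K')
    (c'' : conflation B'' K'') f g f' g' :
  conf_mor c c' f g -> conf_mor c' c'' f' g' -> conf_mor c c'' (f' ∘ f) (g' ∘ g).
Proof.
move=> [h [h1 h2]] [h' [h1' h2']]; exists (h' ∘ h); split.
  by rewrite -compA h1 compA h1' compA.
by rewrite -compA h2 compA h2' compA.
Qed.

Lemma ymor_comp s B K B' K' B'' K'' (e : yseq s B K) (e' : yseq s B' K')
    (e'' : yseq s B'' K'') f g f' g' :
  ymor e e' f g -> ymor e' e'' f' g' -> ymor e e'' (f' ∘ f) (g' ∘ g).
Proof.
elim: s => [|s IH] in B K B' K' B'' K'' e e' e'' f g f' g' *; first exact: conf_mor_comp.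
move=> [k [h1 h2]] [k' [h1' h2']]; exists (k' ∘ k); split; last exact: IH h2 h2'.
exact: conf_mor_comp h1 h1'.
Qed.

Lemma ymor_id s B K (e : yseq s B K) : ymor e e (idm K) (idm B).
Proof.
have cid B1 K1 (c : conflation B1 K1) : conf_mor c c (idm K1) (idm B1).
  by exists (idm (mid c)); rewrite !compm1 !comp1m.
elim: s => [|s IH] in B K e *; first exact: cid.
by exists (idm _); split; [exact: cid|exact: IH].
Qed.

Lemma conf_pushP B K K' (f : hom K K') (c : conflation B K) :
  conf_mor c (conf_push f c) f (idm B).
Proof. by exists (po_map (pushout f (conf_ses c))); rewrite comp1m po_defE po_sq. Qed.

Lemma conf_push_univ B K K' B' K'' (f : hom K K') (f' : hom K' K'') g
    (c : conflation B K) (c' : conflation B' K'') :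
  conf_mor c c' (f' ∘ f) g -> conf_mor (conf_push f c) c' f' g.
Proof.
move=> [h [h1 h2]]; rewrite compA in h1.
have [v v1 v2] := po_univ (pushout f (conf_ses c)) h1.
exists v; split=> //; apply: (@po_ext _ _ _ _ _ _ _ _ (pushout f (conf_ses c))); rewrite -!compA.
  by rewrite po_defE v1.
rewrite [po_def _ ∘ _](po_ses _).1.1 v2 compm0 compA.
by rewrite (conf_ses c').1.1 comp0m.
Qed.

Lemma conf_pullP B B' K (g : hom B' B) (c : conflation B K) :
  conf_mor (conf_pull g c) c (idm K) g.
Proof. by exists (pb_map (pullback g (conf_ses c))); rewrite compm1 pb_infE pb_sq. Qed.

Lemma conf_pull_univ B B' K' B0 K0 (g : hom B' B) (g' : hom B0 B') f
    (c : conflation B K') (c' : conflation B0 K0) :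
  conf_mor c' c f (g ∘ g') -> conf_mor c' (conf_pull g c) f g'.
Proof.
move=> [h [h1 h2]]; rewrite -compA in h2.
have [v v1 v2] := pb_univ (pullback g (conf_ses c)) (esym h2).
exists v; split; last by rewrite /= v2.
apply: (@pb_ext _ _ _ _ _ _ _ _ (pullback g (conf_ses c))); rewrite !compA.
  by rewrite v1 pb_infE.
rewrite [pb_def _ ∘ pb_inf _](pb_ses _).1.1 v2 comp0m -compA.
by rewrite (conf_ses c').1.1 compm0.
Qed.

Lemma ypushP s B K K' (f : hom K K') (e : yseq s B K) : ymor e (ypush f e) f (idm B).
Proof.
case: s e => [|s] e; first exact: conf_pushP.
by exists (idm _); split; [exact: conf_pushP|exact: ymor_id].
Qed.

Lemma ypush_univ s B K K' B' K'' (f : hom K K') (f' : hom K' K'') g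
    (e : yseq s B K) (e' : yseq s B' K'') :
  ymor e e' (f' ∘ f) g -> ymor (ypush f e) e' f' g.
Proof.
case: s e e' => [|s] e e'; first exact: conf_push_univ.
by move=> [k [h1 h2]]; exists k; split=> //; exact: conf_push_univ.
Qed.

Lemma ypullP s B B' K (g : hom B' B) (e : yseq s B K) : ymor (ypull g e) e (idm K) g.
Proof.
elim: s => [|s IH] in B B' K g e *; first exact: conf_pullP.
by exists (idm _); split; [exact: (ymor_id (s := 0))|exact: IH].
Qed.

Lemma ypull_univ s B B' K' B0 K0 (g : hom B' B) (g' : hom B0 B') f
    (e : yseq s B K') (e' : yseq s B0 K0) :
  ymor e' e f (g ∘ g') -> ymor e' (ypull g e) f g'.
Proof.
elim: s => [|s IH] in B B' K' B0 K0 g g' f e e' *; first exact: conf_pull_univ.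
by move=> [k [h1 h2]]; exists k; split=> //; exact: IH.
Qed.

Lemma ysum_mor s B1 K1 B1' K1' B2 K2 B2' K2' (e1 : yseq s B1 K1) (e1' : yseq s B1' K1')
    (e2 : yseq s B2 K2) (e2' : yseq s B2' K2') f1 g1 f2 g2 :
  ymor e1 e1' f1 g1 -> ymor e2 e2' f2 g2 ->
  ymor (ysum e1 e2) (ysum e1' e2') (dmap f1 f2) (dmap g1 g2).
Proof.
have H B K B' K' B3 K3 B3' K3' (c1 : conflation B K) (c1' : conflation B' K')
    (c2 : conflation B3 K3) (c2' : conflation B3' K3') f g f' g' :
    conf_mor c1 c1' f g -> conf_mor c2 c2' f' g' ->
    conf_mor (conf_sum c1 c2) (conf_sum c1' c2') (dmap f f') (dmap g g').
  move=> [h [h1 h2]] [h' [h1' h2']]; exists (dmap h h').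
  by rewrite /= !dmap_comp h1 h1' h2 h2'.
elim: s => [|s IH] in B1 K1 B1' K1' B2 K2 B2' K2' e1 e1' e2 e2' f1 g1 f2 g2 *.
  exact: H.
move=> [k [h1 h2]] [k' [h1' h2']]; exists (dmap k k').
by split; [exact: H h1 h1'|exact: IH h2 h2'].
Qed.

Lemma ysum_swap s B K B' K' (e : yseq s B K) (e' : yseq s B' K') :
  ymor (ysum e e') (ysum e' e)
    (pair_ (prr (dsum K K')) (prl (dsum K K'))) (pair_ (prr (dsum B B')) (prl (dsum B B'))).
Proof.
have H B1 K1 B1' K1' (c : conflation B1 K1) (c' : conflation B1' K1') :
    conf_mor (conf_sum c c') (conf_sum c' c)
      (pair_ (prr (dsum K1 K1')) (prl (dsum K1 K1')))
      (pair_ (prr (dsum B1 B1')) (prl (dsum B1 B1'))).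
  exists (pair_ (prr (dsum (mid c) (mid c'))) (prl (dsum (mid c) (mid c')))).
  by rewrite /= !dmap_pair !pair_comp !prl_pair !prr_pair.
elim: s => [|s IH] in B K B' K' e e' *; first exact: H.
by eexists; split; [exact: H|exact: IH].
Qed.

Definition assocm (X Y Z : A) : hom (dsum (dsum X Y) Z) (dsum X (dsum Y Z)) :=
  pair_ (prl (dsum X Y) ∘ prl (dsum (dsum X Y) Z))
    (pair_ (prr (dsum X Y) ∘ prl (dsum (dsum X Y) Z)) (prr (dsum (dsum X Y) Z))).

Lemma assocm_dmap (X Y Z X' Y' Z' : A) (f : hom X X') (g : hom Y Y') (h : hom Z Z') :
  assocm X' Y' Z' ∘ dmap (dmap f g) h = dmap f (dmap g h) ∘ assocm X Y Z.
Proof.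
rewrite /assocm !dmap_pair !pair_comp -!compA prl_pair prr_pair.
by rewrite /dmap pair_comp prl_pair prr_pair -!compA.
Qed.

Lemma ysum_assoc s B K B' K' B'' K'' (e : yseq s B K) (e' : yseq s B' K') (e'' : yseq s B'' K'') :
  ymor (ysum (ysum e e') e'') (ysum e (ysum e' e'')) (assocm K K' K'') (assocm B B' B'').
Proof.
have H B1 K1 B1' K1' B1'' K1'' (c : conflation B1 K1) (c' : conflation B1' K1')
    (c'' : conflation B1'' K1'') :
    conf_mor (conf_sum (conf_sum c c') c'') (conf_sum c (conf_sum c' c''))
      (assocm K1 K1' K1'') (assocm B1 B1' B1'').
  by exists (assocm (mid c) (mid c') (mid c'')); rewrite /= !assocm_dmap.
elim: s => [|s IH] in B K B' K' B'' K'' e e' e'' *; first exact: H.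
by eexists; split; [exact: H|exact: IH].
Qed.

Lemma ysum_diag s B K (e : yseq s B K) : ymor e (ysum e e) (diagm K) (diagm B).
Proof.
have H B1 K1 (c : conflation B1 K1) : conf_mor c (conf_sum c c) (diagm K1) (diagm B1).
  by exists (diagm (mid c)); rewrite /= /diagm !dmap_pair !pair_comp !comp1m !compm1.
elim: s => [|s IH] in B K e *; first exact: H.
by eexists; split; [exact: H|exact: IH].
Qed.

Lemma ysum_codiag s B K (e : yseq s B K) : ymor (ysum e e) e (codiagm K) (codiagm B).
Proof.
have H B1 K1 (c : conflation B1 K1) : conf_mor (conf_sum c c) c (codiagm K1) (codiagm B1).
  exists (codiagm (mid c)).
  by rewrite /= /codiagm !copair_dmap !comp_copair !comp1m !compm1.
elim: s => [|s IH] in B K e *; first exact: H.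
by eexists; split; [exact: H|exact: IH].
Qed.

Lemma yzeroP s B B' K K' (e : yseq s B K) (g : hom B B') : ymor e (yzero s B' K') 0 g.
Proof.
elim: s => [|s IH] in B B' K K' e g *.
  exists (inr_ (dsum K' B') ∘ (g ∘ defl e)); split; rewrite /=.
    by rewrite -!compA (conf_ses e).1.1 !compm0.
  by rewrite [RHS]compA prr_inr comp1m.
exists 0; split; last exact: IH.
by exists 0; rewrite /= !comp0m !compm0.
Qed.

Lemma yeqv_refl s B K (e : yseq s B K) : yeqv e e. Proof. exact: rst_refl. Qed.

Lemma yeqv_sym s B K (e e' : yseq s B K) : yeqv e e' -> yeqv e' e.
Proof. exact: rst_sym. Qed.

Lemma yeqv_trans s B K (e2 e1 e3 : yseq s B K) : yeqv e1 e2 -> yeqv e2 e3 -> yeqv e1 e3.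
Proof. exact: rst_trans. Qed.

Lemma yeqv_lift s B K s' B' K' (F : yseq s B K -> yseq s' B' K') :
  (forall e e', fixed_ends e e' -> yeqv (F e) (F e')) ->
  forall e e', yeqv e e' -> yeqv (F e) (F e').
Proof.
move=> H e e'; elim=> {e e'}; first by exact: H.
- by move=> e; exact: rst_refl.
- by move=> e e' _ ?; exact: rst_sym.
- by move=> e1 e2 e3 _ h _ h'; exact: rst_trans h h'.
Qed.

Lemma yeqv_push s B K K' (f : hom K K') (e e' : yseq s B K) :
  yeqv e e' -> yeqv (ypush f e) (ypush f e').
Proof.
apply: yeqv_lift => {}e {}e' h; apply/rst_step/ypush_univ.
by have := ymor_comp h (ypushP f e'); rewrite !comp1m compm1.
Qed.

Lemma yeqv_pull s B B' K (g : hom B' B) (e e' : yseq s B K) :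
  yeqv e e' -> yeqv (ypull g e) (ypull g e').
Proof.
apply: yeqv_lift => {}e {}e' h; apply/rst_step/ypull_univ.
by have := ymor_comp (ypullP g e) h; rewrite !comp1m compm1.
Qed.

Lemma yeqv_sum s B K B' K' (e1 e1' : yseq s B K) (e2 e2' : yseq s B' K') :
  yeqv e1 e1' -> yeqv e2 e2' -> yeqv (ysum e1 e2) (ysum e1' e2').
Proof.
move=> h1 h2; apply: (@yeqv_trans _ _ _ (ysum e1' e2)).
  apply: (yeqv_lift (F := fun e => ysum e e2)) h1 => e e' h; apply: rst_step.
  by rewrite /fixed_ends -!dmap1; apply: ysum_mor h (ymor_id _).
apply: (yeqv_lift (F := ysum e1')) h2 => e e' h; apply: rst_step.
by rewrite /fixed_ends -!dmap1; apply: ysum_mor (ymor_id _) h.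
Qed.

Lemma yeqv_splice s B L K (c c' : conflation L K) (e e' : yseq s B L) :
  yeqv (s := 0) c c' -> yeqv e e' -> yeqv (splice c e) (splice c' e').
Proof.
move=> h1 h2; apply: (@yeqv_trans _ _ _ (splice c' e)).
  apply: (yeqv_lift (s := 0) (F := fun c => splice c e)) h1 => {}c {}c' h.
  by apply: rst_step; exists (idm L); split=> //; exact: ymor_id.
apply: (yeqv_lift (F := splice c')) h2 => {}e {}e' h.
by apply: rst_step; exists (idm L); split=> //; exact: (ymor_id (s := 0)).
Qed.

Lemma ymor_eqv s B K B' K' (e : yseq s B K) (e' : yseq s B' K') f g :
  ymor e e' f g -> yeqv (ypush f e) (ypull g e').
Proof.
by move=> h; apply/rst_step/ypull_univ/ypush_univ; rewrite comp1m compm1.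
Qed.

Lemma ypush_comp s B K K' K'' (f : hom K K') (f' : hom K' K'') (e : yseq s B K) :
  yeqv (ypush f' (ypush f e)) (ypush (f' ∘ f) e).
Proof.
apply/yeqv_sym/rst_step/ypush_univ.
by have := ymor_comp (ypushP f e) (ypushP f' _); rewrite !comp1m.
Qed.

Lemma ypush1 s B K (e : yseq s B K) : yeqv (ypush (idm K) e) e.
Proof. by apply/rst_step/ypush_univ; rewrite comp1m; exact: ymor_id. Qed.

Lemma ypull_comp s B B' B'' K (g : hom B' B) (g' : hom B'' B') (e : yseq s B K) :
  yeqv (ypull g' (ypull g e)) (ypull (g ∘ g') e).
Proof.
apply/rst_step/ypull_univ.
by have := ymor_comp (ypullP g' _) (ypullP g e); rewrite !compm1.
Qed.

Lemma ypull1 s B K (e : yseq s B K) : yeqv (ypull (idm B) e) e.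
Proof. by apply/rst_step; exact: ypullP. Qed.

Lemma ypush_pull s B B' K K' (f : hom K K') (g : hom B' B) (e : yseq s B K) :
  yeqv (ypush f (ypull g e)) (ypull g (ypush f e)).
Proof.
by apply: ymor_eqv; have := ymor_comp (ypullP g e) (ypushP f e); rewrite comp1m compm1.
Qed.

Lemma ybimod s B K B' K' (L M : C) (e : yseq s B K) (e' : yseq s B' K') f g
    (u : hom K' L) (v : hom M B) u0 v0 :
  ymor e e' f g -> u0 = u ∘ f -> v0 = g ∘ v ->
  yeqv (ypush u0 (ypull v e)) (ypush u (ypull v0 e')).
Proof.
move=> h -> ->; apply: yeqv_trans (yeqv_sym (ypush_comp _ _ _)) _.
apply: yeqv_push; apply: yeqv_trans (ypush_pull _ _ _) _.
by apply: yeqv_trans (yeqv_pull v (ymor_eqv h)) (ypull_comp _ _ _).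
Qed.

Lemma ybaer_eqv s B K (e1 e1' e2 e2' : yseq s B K) :
  yeqv e1 e1' -> yeqv e2 e2' -> yeqv (ybaer e1 e2) (ybaer e1' e2').
Proof. by move=> h1 h2; apply/yeqv_push/yeqv_pull/yeqv_sum. Qed.

Lemma ybaerC s B K (e e' : yseq s B K) : yeqv (ybaer e e') (ybaer e' e).
Proof.
apply: (ybimod (ysum_swap e e')); rewrite /codiagm ?copair_pair ?pair_comp.
  by rewrite !comp1m addrC /copair !comp1m.
by rewrite /diagm prl_pair prr_pair.
Qed.

Lemma codiag_dmap (X Y Z : A) (f : hom X Z) (g : hom Y Z) :
  codiagm Z ∘ dmap f g = copair f g.
Proof. by rewrite /codiagm copair_dmap !comp1m. Qed.

Lemma dmap_diag (X Y Z : A) (f : hom Z X) (g : hom Z Y) :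
  dmap f g ∘ diagm Z = pair_ f g.
Proof. by rewrite /diagm dmap_pair !compm1. Qed.

Lemma ybaer_push_pull s B K B1 K1 B2 K2 (e1 : yseq s B1 K1) (e2 : yseq s B2 K2)
    (f1 : hom K1 K) (f2 : hom K2 K) (g1 : hom B B1) (g2 : hom B B2) :
  yeqv (ybaer (ypush f1 (ypull g1 e1)) (ypush f2 (ypull g2 e2)))
    (@ypush s B (ex_dsum K1 K2) K (copair f1 f2)
       (@ypull s (ex_dsum B1 B2) B (ex_dsum K1 K2) (pair_ g1 g2) (ysum e1 e2))).
Proof.
apply: (@yeqv_trans _ _ _ (@ypush s B (ex_dsum K1 K2) K (copair f1 f2)
  (@ypull s (ex_dsum B B) B (ex_dsum K1 K2) (diagm B)
     (ysum (ypull g1 e1) (ypull g2 e2))))).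
  apply/yeqv_sym; apply: (ybimod (ysum_mor (ypushP f1 _) (ypushP f2 _))).
    by rewrite codiag_dmap.
  by rewrite dmap1 comp1m.
apply: (ybimod (ysum_mor (ypullP g1 _) (ypullP g2 _))).
  by rewrite dmap1 compm1.
by rewrite dmap_diag.
Qed.

Lemma yeqv_push_pull1 s B K (e : yseq s B K) : yeqv (ypush (idm K) (ypull (idm B) e)) e.
Proof. exact: yeqv_trans (ypush1 _) (ypull1 _). Qed.

Lemma ybaerA s B K (e1 e2 e3 : yseq s B K) :
  yeqv (ybaer e1 (ybaer e2 e3)) (ybaer (ybaer e1 e2) e3).
Proof.
apply: yeqv_trans (ybaer_eqv (yeqv_sym (yeqv_push_pull1 _)) (yeqv_refl _)) _.
apply: yeqv_trans (ybaer_push_pull (B1 := B) (K1 := K) _ _ _ _ _ _) _.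
apply: yeqv_sym.
apply: yeqv_trans (ybaer_eqv (yeqv_refl _) (yeqv_sym (yeqv_push_pull1 _))) _.
apply: yeqv_trans (ybaer_push_pull (B2 := B) (K2 := K) _ _ _ _ _ _) _.
apply: (ybimod (ysum_assoc e1 e2 e3)).
  by rewrite /assocm /codiagm !copair_pair /copair !compDl !compA !comp1m addrA.
by rewrite /assocm /diagm !pair_comp -!compA !prl_pair !prr_pair.
Qed.

Lemma ypushD s B K K' (f f' : hom K K') (e : yseq s B K) :
  yeqv (ypush (f + f') e) (ybaer (ypush f e) (ypush f' e)).
Proof.
have h (u : hom K K') : yeqv (ypush u e) (ypush u (ypull (idm B) e)).
  by apply/yeqv_sym/yeqv_push/ypull1.
apply: yeqv_sym; apply: yeqv_trans (ybaer_eqv (h f) (h f')) _.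
apply: yeqv_trans (ybaer_push_pull (K1 := K) (K2 := K) _ _ _ _ _ _) _.
apply: yeqv_sym; apply: yeqv_trans (h (f + f')) _.
apply: (ybimod (ysum_diag e)).
  by rewrite /diagm copair_pair !compm1.
by rewrite /diagm pair_comp !compm1.
Qed.

Lemma ypullD s B B' K (g g' : hom B' B) (e : yseq s B K) :
  yeqv (ypull (g + g') e) (ybaer (ypull g e) (ypull g' e)).
Proof.
have h (u : hom B' B) : yeqv (ypull u e) (ypush (idm K) (ypull u e)).
  exact: (yeqv_sym (ypush1 _)).
apply: yeqv_sym; apply: yeqv_trans (ybaer_eqv (h g) (h g')) _.
apply: yeqv_trans (ybaer_push_pull (B1 := B) (B2 := B) (K1 := K) (K2 := K) _ _ _ _ _ _) _.
apply: yeqv_sym; apply: yeqv_trans (h (g + g')) _; apply: yeqv_sym.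
apply: (ybimod (ysum_codiag e)).
  by rewrite comp1m.
by rewrite /codiagm copair_pair !comp1m.
Qed.

Lemma ypush_baer s B K K' (f : hom K K') (e e' : yseq s B K) :
  yeqv (ypush f (ybaer e e')) (ybaer (ypush f e) (ypush f e')).
Proof.
apply: yeqv_trans (ypush_comp _ _ _) _.
apply: (ybimod (ysum_mor (ypushP f e) (ypushP f e'))).
  by rewrite codiag_dmap /codiagm comp_copair !compm1.
by rewrite dmap1 comp1m.
Qed.

Lemma ypull_baer s B B' K (g : hom B' B) (e e' : yseq s B K) :
  yeqv (ypull g (ybaer e e')) (ybaer (ypull g e) (ypull g e')).
Proof.
apply: yeqv_trans (yeqv_sym (ypush_pull _ _ _)) _.
apply: yeqv_trans (yeqv_push _ (ypull_comp _ _ _)) _.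
apply/yeqv_sym/(ybimod (ysum_mor (ypullP g e) (ypullP g e'))).
  by rewrite dmap1 compm1.
by rewrite dmap_diag /diagm pair_comp !comp1m.
Qed.

Lemma ypush0 s B K K' (e : yseq s B K) : yeqv (ypush (0 : hom K K') e) (yzero s B K').
Proof. by apply/rst_step/ypush_univ; rewrite compm0; exact: yzeroP. Qed.

End Extensions.

Section ExtGroup.
Variables (A : abelian) (C : ext_closed A).

HB.instance Definition _ s B K := gen_eqMixin (@yseq A C s B K).
HB.instance Definition _ s B K := gen_choiceMixin (@yseq A C s B K).

Section FixedEnds.
Variables (s : nat) (B K : C).

Definition yrel : rel (yseq s B K) := fun e e' => `[< yeqv e e' >].

Lemma yrel_equiv : equiv_class_of yrel.
Proof.
split=> [e|e e'|e2 e1 e3]; first exact/asboolP/yeqv_refl.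
  by apply/asboolP/asboolP; exact: yeqv_sym.
by move=> /asboolP h /asboolP h'; apply/asboolP; exact: yeqv_trans h h'.
Qed.

Canonical yrel_equiv_rel := EquivRelPack yrel_equiv.
Canonical yrel_encModRel := defaultEncModRel yrel.

(* Index shift: [yext s] is Ext^{s+1}. *)
Definition yext := {eq_quot yrel}.
HB.instance Definition _ := Choice.on yext.
HB.instance Definition _ := EqQuotient.on yext.

Lemma yextP (e e' : yseq s B K) : \pi_yext e = \pi_yext e' <-> yeqv e e'.
Proof. by split=> [/eqquotP/asboolP //|h]; apply/eqquotP/asboolP. Qed.

Lemma yext_repr (e : yseq s B K) : yeqv (repr (\pi_yext e)) e.
Proof. by apply/yextP; rewrite reprK. Qed.

Definition yext_zero : yext := \pi_yext (yzero s B K).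
Definition yext_add (x y : yext) : yext := \pi_yext (ybaer (repr x) (repr y)).
Definition yext_opp (x : yext) : yext := \pi_yext (yopp (repr x)).

Lemma yext_addE e e' : yext_add (\pi_yext e) (\pi_yext e') = \pi_yext (ybaer e e').
Proof. by apply/yextP/ybaer_eqv; exact: yext_repr. Qed.

Lemma yext_oppE e : yext_opp (\pi_yext e) = \pi_yext (yopp e).
Proof. by apply/yextP/yeqv_push; exact: yext_repr. Qed.

Lemma yext_addA : associative yext_add.
Proof.
elim/quotW=> x; elim/quotW=> y; elim/quotW=> z.
rewrite (yext_addE y z) (yext_addE x y) yext_addE yext_addE; exact/yextP/ybaerA.
Qed.

Lemma yext_addC : commutative yext_add.
Proof. by elim/quotW=> x; elim/quotW=> y; rewrite !yext_addE; exact/yextP/ybaerC. Qed.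

Lemma yext_add0 : left_id yext_zero yext_add.
Proof.
elim/quotW=> x; rewrite yext_addE; apply/yextP.
apply: yeqv_trans (ybaer_eqv (yeqv_sym (ypush0 _ x)) (yeqv_sym (ypush1 x))) _.
apply: yeqv_trans (yeqv_sym (ypushD _ _ x)) _.
by rewrite add0r; exact: ypush1.
Qed.

Lemma yext_addN : left_inverse yext_zero yext_opp yext_add.
Proof.
elim/quotW=> x; rewrite yext_oppE yext_addE; apply/yextP.
apply: yeqv_trans (ybaer_eqv (yeqv_refl _) (yeqv_sym (ypush1 x))) _.
apply: yeqv_trans (yeqv_sym (ypushD _ _ x)) _.
by rewrite addNr; exact: ypush0.
Qed.

HB.instance Definition _ := GRing.isZmodule.Build yext
  yext_addA yext_addC yext_add0 yext_addN.

End FixedEnds.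

Definition Ext (t : nat) (B K : C) : zmodType :=
  match t with
  | 0 => hom B K
  | s.+1 => yext s B K
  end.

(* An extension of length [t], before passing to classes; for [t = 0] it is a
   morphism. *)
Definition extension (t : nat) (B K : C) : Type :=
  match t with
  | 0 => hom B K
  | s.+1 => yseq s B K
  end.

Definition cls t B K : extension t B K -> Ext t B K :=
  match t with
  | 0 => fun f => f
  | s.+1 => fun e => \pi_(yext s B K) e
  end.

Lemma cls_surj t B K (x : Ext t B K) : exists e, cls e = x.
Proof. by case: t x => [|s] x; [exists x|exists (repr x); rewrite /= reprK]. Qed.

(* [push f x] is the Yoneda product [f x], and [pull g x] is [x g]. *)
Definition push t (B K K' : C) (f : hom K K') : Ext t B K -> Ext t B K' :=
  match t with
  | 0 => fun x => f ∘ x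
  | s.+1 => fun x : yext s B K => \pi_(yext s B K') (ypush f (repr x))
  end.

Definition pull t (B B' K : C) (g : hom B' B) : Ext t B K -> Ext t B' K :=
  match t with
  | 0 => fun x => x ∘ g
  | s.+1 => fun x : yext s B K => \pi_(yext s B' K) (ypull g (repr x))
  end.

(* Product of a conflation with an extension of length [t], before passing to
   classes: pull-back for [t = 0], splicing otherwise. *)
Definition ymul1 t B L K (c : conflation L K) : extension t B L -> extension t.+1 B K :=
  match t with
  | 0 => fun g => conf_pull g c
  | s.+1 => fun e => splice c e
  end.

(* Yoneda product of a class of degree 1 with a class of degree [t]; see [mul1E]
   for the independence of the representatives. *)
Definition mul1 t B L K (x : Ext 1 L K) : Ext t B L -> Ext t.+1 B K :=
  match t with
  | 0 => fun g => pull (t := 1) g x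
  | s.+1 => fun y : yext s B L => \pi_(yext s.+1 B K) (splice (repr (x : yext 0 L K)) (repr y))
  end.

Lemma pushE s (B K K' : C) (f : hom K K') (e : yseq s B K) :
  push (t := s.+1) f (cls (t := s.+1) e) = cls (t := s.+1) (ypush f e).
Proof. by apply/yextP/yeqv_push; exact: yext_repr. Qed.

Lemma pullE s (B B' K : C) (g : hom B' B) (e : yseq s B K) :
  pull (t := s.+1) g (cls (t := s.+1) e) = cls (t := s.+1) (ypull g e).
Proof. by apply/yextP/yeqv_pull; exact: yext_repr. Qed.

Lemma addE s (B K : C) (e e' : yseq s B K) :
  cls (t := s.+1) e + cls (t := s.+1) e' = cls (t := s.+1) (ybaer e e').
Proof. exact: yext_addE. Qed.

Lemma mul1E t B L K (c : conflation L K) (e : extension t B L) :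
  mul1 (cls (t := 1) c) (cls e) = cls (ymul1 c e).
Proof.
case: t e => [|s] e; first exact: (pullE (s := 0)).
by apply/yextP/yeqv_splice; exact: yext_repr.
Qed.

Lemma push_comp t (B K K' K'' : C) (f : hom K K') (f' : hom K' K'') (x : Ext t B K) :
  push f' (push f x) = push (f' ∘ f) x.
Proof.
have [{}x <-] := cls_surj x; case: t x => [|s] x; first exact: compA.
by rewrite !pushE; exact/yextP/ypush_comp.
Qed.

Lemma push1 t B K (x : Ext t B K) : push (idm K) x = x.
Proof.
have [{}x <-] := cls_surj x; case: t x => [|s] x; first exact: comp1m.
by rewrite !pushE; exact/yextP/ypush1.
Qed.

Lemma push_addr t (B K K' : C) (f : hom K K') (x y : Ext t B K) :
  push f (x + y) = push f x + push f y.
Proof.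
have [{}x <-] := cls_surj x; have [{}y <-] := cls_surj y.
case: t x y => [|s] x y; first exact: compDr.
by rewrite addE !pushE addE; exact/yextP/ypush_baer.
Qed.

Lemma push_addl t (B K K' : C) (f f' : hom K K') (x : Ext t B K) :
  push (f + f') x = push f x + push f' x.
Proof.
have [{}x <-] := cls_surj x; case: t x => [|s] x; first exact: compDl.
by rewrite !pushE addE; exact/yextP/ypushD.
Qed.

Lemma pull_comp t (B B' B'' K : C) (g : hom B' B) (g' : hom B'' B') (x : Ext t B K) :
  pull g' (pull g x) = pull (g ∘ g') x.
Proof.
have [{}x <-] := cls_surj x; case: t x => [|s] x; first by rewrite /= compA.
by rewrite !pullE; exact/yextP/ypull_comp.
Qed.

Lemma pull1 t B K (x : Ext t B K) : pull (idm B) x = x.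
Proof.
have [{}x <-] := cls_surj x; case: t x => [|s] x; first exact: compm1.
by rewrite !pullE; exact/yextP/ypull1.
Qed.

Lemma pull_addr t (B B' K : C) (g : hom B' B) (x y : Ext t B K) :
  pull g (x + y) = pull g x + pull g y.
Proof.
have [{}x <-] := cls_surj x; have [{}y <-] := cls_surj y.
case: t x y => [|s] x y; first exact: compDl.
by rewrite addE !pullE addE; exact/yextP/ypull_baer.
Qed.

Lemma pull_addl t (B B' K : C) (g g' : hom B' B) (x : Ext t B K) :
  pull (g + g') x = pull g x + pull g' x.
Proof.
have [{}x <-] := cls_surj x; case: t x => [|s] x; first exact: compDr.
by rewrite !pullE addE; exact/yextP/ypullD.
Qed.

Lemma push_pull t (B B' K K' : C) (f : hom K K') (g : hom B' B) (x : Ext t B K) :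
  push f (pull g x) = pull g (push f x).
Proof.
have [{}x <-] := cls_surj x; case: t x => [|s] x; first by rewrite /= compA.
by rewrite pullE !pushE pullE; exact/yextP/ypush_pull.
Qed.

Lemma push_0l t (B K K' : C) (x : Ext t B K) : push (0 : hom K K') x = 0.
Proof. by apply: (addrI (push 0 x)); rewrite -push_addl !addr0. Qed.

Lemma push_0r t (B K K' : C) (f : hom K K') : push f (0 : Ext t B K) = 0.
Proof. by apply: (addrI (push f 0)); rewrite -push_addr !addr0. Qed.

Lemma push_Nl t (B K K' : C) (f : hom K K') (x : Ext t B K) : push (- f) x = - push f x.
Proof. by apply: (addrI (push f x)); rewrite -push_addl !subrr push_0l. Qed.

Lemma push_Nr t (B K K' : C) (f : hom K K') (x : Ext t B K) : push f (- x) = - push f x.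
Proof. by apply: (addrI (push f x)); rewrite -push_addr !subrr push_0r. Qed.

Lemma pull_0l t (B B' K : C) (x : Ext t B K) : pull (0 : hom B' B) x = 0.
Proof. by apply: (addrI (pull 0 x)); rewrite -pull_addl !addr0. Qed.

Lemma pull_0r t (B B' K : C) (g : hom B' B) : pull g (0 : Ext t B K) = 0.
Proof. by apply: (addrI (pull g 0)); rewrite -pull_addr !addr0. Qed.

End ExtGroup.

Section Frobenius.
Variables (A : abelian) (C : ext_closed A) (n : nat).
Implicit Types X Y M N T P I : C.

Definition nproj P : Prop := forall i, (n < i)%N -> forall X (x : Ext i P X), x = 0.
Definition ninj I : Prop := forall i, (n < i)%N -> forall X (x : Ext i X I), x = 0.

Definition enough_nproj : Prop :=
  forall X, exists (K P : C) (i : hom K P) (p : hom P X), nproj P /\ short_exact i p.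
Definition enough_ninj : Prop :=
  forall X, exists (I Q : C) (i : hom X I) (p : hom I Q), ninj I /\ short_exact i p.

Definition nFrobenius : Prop :=
  [/\ enough_nproj, enough_ninj & forall X, nproj X <-> ninj X].

(* [unit_ext d]: [d] is a unit extension [X = Ω^t N -> P_{t-1} -> ... -> P_0 -> N]. *)
Inductive unit_ext N : forall (t : nat) X, extension t N X -> Prop :=
| unit_ext0 : @unit_ext N 0 N (idm N)
| unit_extS s X (e : yseq s N X) : all_mid nproj e -> @unit_ext N s.+1 X e.

Lemma nproj_dsum P P' : nproj P -> nproj P' -> nproj (ex_dsum P P').
Proof.
move=> hP hP' i ni X x; rewrite -[x]pull1 -[idm _]bip_id pull_addl.
rewrite -(pull_comp (B' := P)) -(pull_comp (B' := P')).
by rewrite (hP i ni _ (pull _ x)) (hP' i ni _ (pull _ x)) !pull_0r addr0.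
Qed.

Lemma nproj_ob0 : nproj (ex_ob0 C).
Proof. by move=> i _ X x; rewrite -[x]pull1 [idm _]ob0_init pull_0l. Qed.

Definition nproj_sub X Y (x : Ext n X Y) : bool :=
  `[< exists P (f : hom P Y) (b : Ext n X P), nproj P /\ x = push f b >].

Lemma nproj_sub_zmod_closed X Y : zmod_closed (@nproj_sub X Y).
Proof.
split=> [|x y].
  apply/asboolP; exists (ex_ob0 C), 0, 0; split; first exact: nproj_ob0.
  by rewrite push_0r.
move=> /asboolP[P [f [b [hP ->]]]] /asboolP[P' [f' [b' [hP' ->]]]].
apply/asboolP; exists (ex_dsum P P'), (copair f (- f')).
exists (push (K' := ex_dsum P P') (inl_ (dsum P P')) b
        + push (K' := ex_dsum P P') (inr_ (dsum P P')) b').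
split; first exact: nproj_dsum.
by rewrite push_addr !push_comp copair_inl copair_inr push_Nl.
Qed.

HB.instance Definition _ X Y :=
  GRing.isZmodClosed.Build (Ext n X Y) (@nproj_sub X Y) (@nproj_sub_zmod_closed X Y).

Definition ExtP X Y : zmodType :=
  Quotient.quot (GRing.ZmodClosed.clone (Ext n X Y) (@nproj_sub X Y) _).

End Frobenius.

Section NatTrans.
Variables (A : abelian) (C : ext_closed A) (t : nat) (N M : C).

Record nat_trans := NatTrans {
  nt_fun :> forall T : C, Ext t N T -> Ext t M T;
  nt_add : forall (T : C) (x y : Ext t N T), nt_fun (x + y) = nt_fun x + nt_fun y;
  nt_nat : forall (T T' : C) (f : hom T T') (x : Ext t N T),
    nt_fun (push f x) = push f (nt_fun x) }.

Lemma nat_transP (u v : nat_trans) : (forall T (x : Ext t N T), u T x = v T x) -> u = v.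
Proof.
case: u v => [u u1 u2] [v v1 v2] /= E.
have {}E : u = v by apply: functional_extensionality_dep => T; exact/funext/E.
by subst v; congr NatTrans; exact: Prop_irrelevance.
Qed.

HB.instance Definition _ := gen_eqMixin nat_trans.
HB.instance Definition _ := gen_choiceMixin nat_trans.

Program Definition nt_zero : nat_trans := @NatTrans (fun T _ => 0) _ _.
Next Obligation. by rewrite addr0. Qed.
Next Obligation. by rewrite push_0r. Qed.

Program Definition nt_plus (u v : nat_trans) : nat_trans :=
  @NatTrans (fun T x => u T x + v T x) _ _.
Next Obligation. by rewrite !nt_add addrACA. Qed.
Next Obligation. by rewrite !nt_nat push_addr. Qed.

Program Definition nt_opp (u : nat_trans) : nat_trans :=
  @NatTrans (fun T x => - u T x) _ _.
Next Obligation. by rewrite nt_add opprD. Qed.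
Next Obligation. by rewrite nt_nat push_Nr. Qed.

Lemma nt_plusA : associative nt_plus.
Proof. by move=> u v w; apply: nat_transP => T x; rewrite /= addrA. Qed.

Lemma nt_plusC : commutative nt_plus.
Proof. by move=> u v; apply: nat_transP => T x; rewrite /= addrC. Qed.

Lemma nt_plus0 : left_id nt_zero nt_plus.
Proof. by move=> u; apply: nat_transP => T x; rewrite /= add0r. Qed.

Lemma nt_plusN : left_inverse nt_zero nt_opp nt_plus.
Proof. by move=> u; apply: nat_transP => T x; rewrite /= addNr. Qed.

HB.instance Definition _ := GRing.isZmodule.Build nat_trans
  nt_plusA nt_plusC nt_plus0 nt_plusN.

End NatTrans.

Section Psi.
Variables (A : abelian) (C : ext_closed A) (n : nat).
Implicit Types N M T X : C.

Definition nproj_inflation (X Y : C) (a : hom X Y) : Prop :=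
  exists (P : C) (p : hom Y P), nproj n P /\ short_exact a p.

Definition angled_pair (N X X' Y : C) (d : extension n N X) (d' : extension n N X')
    (a : hom X Y) (b : hom X' Y) : Prop :=
  [/\ nproj_inflation a, nproj_inflation b & push a (cls d) = push b (cls d')].

(* [psi_value d g al be]: for some choices of [δ'_N] (here [d']), of a
   representative [e] of [α], of a conflation [c] representing [α_1] with a
   morphism [α_1 δ'_N -> α] with fixed ends, of an angled pair [a], [b] and of
   [γ' = b^{-1} a γ] (here [g']), the element [be] is [α_1 γ']. *)
Definition psi_value (M N Om T : C) (d : extension n N Om) (g : Ext n M Om)
    (al : Ext n.+1 N T) (be : Ext n.+1 M T) : Prop :=
  exists (Om' : C) (d' : extension n N Om') (c : conflation Om' T)
    (e : extension n.+1 N T) (Om'' : C) (a : hom Om Om'') (b : hom Om' Om'')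
    (g' : Ext n M Om'),
    [/\ unit_ext n d',
        cls e = al /\ fixed_ends (s := n) (ymul1 c d') e,
        angled_pair d d' a b,
        nproj_sub (push a g - push b g')
      & be = mul1 (cls (t := 1) c) g'].

End Psi.

(* Main.v *)
(** Every [α] in [Ext^{n+1}(N, T)] is a product [x δ'] with [x] of degree [1] and
    [δ'] a unit extension, and [Ψ_γ(x δ') = x γ'].  Everything rests on the long
    exact sequences of Yoneda [Ext] and on the following consequence of them:
    if [δ'] is a unit extension and [x δ' = 0], then [x g = 0] for every [g] of
    degree [n].  Indeed multiplication on the left by conflations with
    [n]-projective, hence [n]-injective, middle term is injective in degrees [> n],
    and so is multiplication on the right by those making up [δ'].  The same argument
    shows that [x] kills [P], and [P] is exactly the kernel of [g |-> ε g] for a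
    conflation [ε : K -> Q -> Ω] with [Q] [n]-projective.

    Independence of the choices follows by dominating two unit extensions by a third
    one.  Injectivity is read off [Ψ_γ(ε δ_N) = ε γ].  For surjectivity, a natural
    [F] sends [ε δ_N] into the kernel of [Ext^{n+1}(M, K) -> Ext^{n+1}(M, Q)], hence
    to some [ε γ], and a natural transformation vanishing at [ε δ_N] vanishes, by
    Schanuel's lemma. *)

From HB Require Import structures.
From mathcomp Require Import all_boot all_order all_algebra.
From mathcomp Require Import boolp.
From Stdlib Require Import Relation_Operators.
Require Import Defs.
Set Implicit Arguments.
Unset Strict Implicit.
Unset Printing Implicit Defensive.
Import GRing.Theory.
Local Open Scope ring_scope.
Local Open Scope quotient_scope.
Local Open Scope cat_scope.

(** * Squares in abelian categories *)

Section AbelianSquares.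
Variable A : abelian.
Implicit Types X Y Z W K L R : A.

Lemma epi_comp X Y Z (p : hom X Y) (q : hom Y Z) : is_epi p -> is_epi q -> is_epi (q ∘ p).
Proof. by move=> ep eq W u v; rewrite !compA => /ep /eq. Qed.

Lemma mono_comp X Y Z (i : hom X Y) (j : hom Y Z) : is_mono i -> is_mono j -> is_mono (j ∘ i).
Proof. by move=> mi mj W u v; rewrite -!compA => /mj /mi. Qed.

Lemma ses_mono X Y Z (i : hom X Y) (p : hom Y Z) : short_exact i p -> is_mono i.
Proof. by case=> /kernel_mono. Qed.

Lemma ses_epi X Y Z (i : hom X Y) (p : hom Y Z) : short_exact i p -> is_epi p.
Proof. by case=> _ /cokernel_epi. Qed.

Lemma ses0 X Y Z (i : hom X Y) (p : hom Y Z) : short_exact i p -> p ∘ i = 0.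
Proof. by case=> -[]. Qed.

Lemma ses_lift X Y Z W (i : hom X Y) (p : hom Y Z) (u : hom W Y) :
  short_exact i p -> p ∘ u = 0 -> exists v, i ∘ v = u.
Proof. by move=> [[_ k] _] /k[v [E _]]; exists v. Qed.

Lemma ses_desc X Y Z W (i : hom X Y) (p : hom Y Z) (u : hom Y W) :
  short_exact i p -> u ∘ i = 0 -> exists v, v ∘ p = u.
Proof. by move=> [_ [_ k]] /k[v [E _]]; exists v. Qed.

Lemma comp_eq0r X Y Z (i : hom Y Z) (u : hom X Y) : is_mono i -> i ∘ u = 0 -> u = 0.
Proof. by move=> mi E; apply: mi; rewrite E compm0. Qed.

Lemma comp_eq0l X Y Z (p : hom X Y) (u : hom Y Z) : is_epi p -> u ∘ p = 0 -> u = 0.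
Proof. by move=> mi E; apply: mi; rewrite E comp0m. Qed.

Lemma compBl X Y Z (f g : hom Y Z) (h : hom X Y) : (f - g) ∘ h = f ∘ h - g ∘ h.
Proof. by rewrite compDl compNl. Qed.

Lemma compBr X Y Z (f : hom Y Z) (g h : hom X Y) : f ∘ (g - h) = f ∘ g - f ∘ h.
Proof. by rewrite compDr compNr. Qed.

Lemma retraction_section K E L (i : hom K E) (p : hom E L) : short_exact i p ->
  (exists r : hom E K, r ∘ i = idm K) <-> (exists s : hom L E, p ∘ s = idm L).
Proof.
move=> S; split=> [[r ri]|[s ps]].
  have [|s sp] := ses_desc (u := idm E - i ∘ r) S.
    by rewrite compBl -compA ri comp1m compm1 subrr.
  exists s; apply: (ses_epi S).
  by rewrite -compA sp compBr compA (ses0 S) comp0m subr0 compm1 comp1m.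
have [|r ir] := ses_lift (u := idm E - s ∘ p) S.
  by rewrite compBr compA ps comp1m compm1 subrr.
exists r; apply: (ses_mono S).
by rewrite compA ir compBl -compA (ses0 S) compm0 subr0 compm1 comp1m.
Qed.

(** A morphism of short exact sequences that is the identity on the left end has a cartesian
    right-hand square; the sequence attached to that square is used later as a new conflation. *)
Lemma cartesian_ses K E1 L1 E2 L2 (i1 : hom K E1) (p1 : hom E1 L1)
    (i2 : hom K E2) (p2 : hom E2 L2) (h : hom E1 E2) (k : hom L1 L2) :
  short_exact i1 p1 -> short_exact i2 p2 -> h ∘ i1 = i2 -> k ∘ p1 = p2 ∘ h ->
  short_exact (pair_ h p1) (copair p2 (- k)).
Proof.
move=> S1 S2 hi kp; apply: epi_ses.
  move=> W u v /(congr1 (fun w => w ∘ inl_ _)); rewrite -!compA copair_inl.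
  exact: ses_epi S2 _ _ _.
apply: kernelP; first by rewrite copair_pair compNl kp subrr.
  apply: mono0 => W u E.
  have p1u : p1 ∘ u = 0 by rewrite -(prr_pair h p1) -compA E compm0.
  have hu : h ∘ u = 0 by rewrite -(prl_pair h p1) -compA E compm0.
  have [v vE] := ses_lift S1 p1u; rewrite -vE compA hi in hu.
  by rewrite -vE (comp_eq0r (ses_mono S2) hu) compm0.
move=> W u E.
set a := prl _ ∘ u; set b := prr _ ∘ u.
have uE : u = pair_ a b by apply: pair_ext; rewrite ?prl_pair ?prr_pair.
have ab : p2 ∘ a = k ∘ b.
  by apply/eqP; rewrite -subr_eq0 -compNl -copair_pair -uE E.
clearbody a b.
suff [v v1 v2] : exists2 v : hom W E1, h ∘ v = a & p1 ∘ v = b.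
  by exists v; rewrite uE pair_comp v1 v2.
(* Over the epimorphism [pb_def pb], [b] lifts to [E1]. The defect [w] measures how far this lift is
   from mapping to [a]; the corrected lift vanishes on [pb_inf pb], hence descends to [W]. *)
pose pb := pullback b S1.
have [w wE] : exists w, i2 ∘ w = a ∘ pb_def pb - h ∘ pb_map pb.
  apply: (ses_lift S2); rewrite compBr !compA ab -kp -!compA (pb_sq pb).
  exact: subrr.
have [v vE] : exists v, v ∘ pb_def pb = i1 ∘ w + pb_map pb.
  apply: (ses_desc (pb_ses pb)); rewrite compDl pb_infE -compA.
  have -> : w ∘ pb_inf pb = - idm K.
    apply: (ses_mono S2); rewrite compA wE compBl -!compA pb_infE (ses0 (pb_ses pb)).
    by rewrite hi compm0 sub0r compNr compm1.
  by rewrite compNr compm1 addNr.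
exists v; apply: (ses_epi (pb_ses pb)); rewrite -compA vE compDr !compA.
  by rewrite hi wE subrK.
by rewrite (ses0 S1) comp0m add0r pb_sq.
Qed.

(** Dual to [cartesian_ses]: the identity on the right end makes the left-hand square
    cocartesian. *)
Lemma cocartesian_ses L E1 K1 E2 K2 (i1 : hom K1 E1) (p1 : hom E1 L)
    (i2 : hom K2 E2) (p2 : hom E2 L) (h : hom E1 E2) (k : hom K1 K2) :
  short_exact i1 p1 -> short_exact i2 p2 -> p2 ∘ h = p1 -> h ∘ i1 = i2 ∘ k ->
  short_exact (pair_ i1 (- k)) (copair h i2).
Proof.
move=> S1 S2 ph ik; apply: mono_ses.
  move=> W u v /(congr1 (comp (prl _))); rewrite !compA prl_pair.
  exact: ses_mono S1 _ _ _.
apply: cokernelP; first by rewrite copair_pair compNr ik subrr.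
  apply: epi0 => W u E.
  have ui2 : u ∘ i2 = 0 by rewrite -(copair_inr h i2) compA E comp0m.
  have uh : u ∘ h = 0 by rewrite -(copair_inl h i2) compA E comp0m.
  have [v vE] := ses_desc S2 ui2; rewrite -vE -compA ph in uh.
  by rewrite -vE (comp_eq0l (ses_epi S1) uh) comp0m.
move=> W u E.
set a := u ∘ inl_ _; set b := u ∘ inr_ _.
have uE : u = copair a b by apply: copair_ext; rewrite ?copair_inl ?copair_inr.
have ab : a ∘ i1 = b ∘ k.
  by apply/eqP; rewrite -subr_eq0 -compNr -copair_pair -uE E.
clearbody a b.
suff [v v1 v2] : exists2 v : hom E2 W, v ∘ h = a & v ∘ i2 = b.
  by exists v; rewrite uE comp_copair v1 v2.
pose po := pushout b S2.
have [w wE] : exists w, w ∘ p1 = po_map po ∘ h - po_inf po ∘ a.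
  apply: (ses_desc S1).
  by rewrite compBl -!compA ab ik !compA (po_sq po) subrr.
have ws : po_def po ∘ w = idm L.
  apply: (ses_epi S1); rewrite -compA wE compBr !compA po_defE (ses0 (po_ses po)).
  by rewrite ph comp0m subr0 comp1m.
have [v vE] : exists v, po_inf po ∘ v = po_map po - w ∘ p2.
  by apply: (ses_lift (po_ses po)); rewrite compBr compA ws po_defE comp1m subrr.
exists v; apply: (ses_mono (po_ses po)); rewrite compA vE compBl -compA.
  by rewrite ph wE opprB addrC subrK.
by rewrite (ses0 S2) compm0 subr0 po_sq.
Qed.

(** The pull-back of [Q] along an inflation is the kernel of the composite from [Q] to the cokernel
    of that inflation. *)
Lemma pullback_infl_ses K Q X Y R (b : hom X Y) (p : hom Y R) (i : hom K Q) (q : hom Q Y)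
    (S : short_exact i q) :
  short_exact b p -> short_exact (pb_map (pullback b S)) (p ∘ q).
Proof.
move=> Sb; set pb := pullback b S; apply: epi_ses.
  exact: epi_comp (ses_epi S) (ses_epi Sb).
apply: kernelP; first by rewrite -compA pb_sq compA (ses0 Sb) comp0m.
  apply: mono0 => W u E; apply: (@pb_ext _ _ _ _ _ _ _ _ pb); first by rewrite E compm0.
  by rewrite compm0; apply: (ses_mono Sb); rewrite compA -pb_sq -compA E !compm0.
move=> W u; rewrite -compA => /(ses_lift Sb)[v vE].
by have [w wE _] := pb_univ pb (esym vE); exists w.
Qed.

(** For [X] inside [Y] inside [V], the push-out is [V/X], seen as an extension of [V/Y] by [Y/X]. *)
Lemma pushout_defl_ses X Y R V W (j : hom X Y) (p : hom Y R) (k : hom Y V) (q : hom V W)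
    (S : short_exact k q) :
  short_exact j p -> short_exact (k ∘ j) (po_map (pushout p S)).
Proof.
move=> Sj; set po := pushout p S; apply: mono_ses.
  exact: mono_comp (ses_mono Sj) (ses_mono S).
apply: cokernelP; first by rewrite compA po_sq -compA (ses0 Sj) compm0.
  apply: epi0 => Z u E; apply: (@po_ext _ _ _ _ _ _ _ _ po); first by rewrite E comp0m.
  by rewrite comp0m; apply: (ses_epi Sj); rewrite -compA -po_sq compA E !comp0m.
move=> Z u; rewrite compA => /(ses_desc Sj)[v vE].
by have [w wE _] := po_univ po (esym vE); exists w.
Qed.

Lemma pushout_infl_ses X Y R X' R' (j : hom X Y) (p : hom Y R) (j' : hom X X')
    (p' : hom X' R') (S : short_exact j p) :
  short_exact j' p' -> exists q : hom _ R', short_exact (po_map (pushout j' S)) q.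
Proof.
move=> S'; set po := pushout j' S.
have SS := cocartesian_ses S (po_ses po) (po_defE po) (po_sq po).
have [q q1 q2] : exists2 q, q ∘ po_map po = 0 & q ∘ po_inf po = p'.
  by apply: po_univ; rewrite comp0m (ses0 S').
exists q; apply: mono_ses.
  apply: mono0 => W u E; have [|v vE] := ses_lift (u := inl_ _ ∘ u) SS.
    by rewrite compA copair_inl.
  have v0 : v = 0.
    apply: (comp_eq0r (ses_mono S')).
    have /(congr1 (comp (prr _))) := vE.
    rewrite !compA prr_pair prr_inl comp0m compNl => /eqP.
    by rewrite oppr_eq0 => /eqP.
  have /(congr1 (comp (prl _))) := vE.
  by rewrite v0 compm0 compm0 compA prl_inl comp1m.
apply: cokernelP => //.
  apply: epi0 => W u E; apply: (comp_eq0l (ses_epi S')).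
  by rewrite -q2 compA E comp0m.
move=> W w E; have [|y yE] := ses_desc (u := w ∘ po_inf po) S'.
  by rewrite -compA -(po_sq po) compA E comp0m.
exists y; apply: (@po_ext _ _ _ _ _ _ _ _ po); rewrite -compA ?q1 ?q2 //.
by rewrite compm0 E.
Qed.

Lemma pullback_defl_ses K1 K2 P1 P2 L (i1 : hom K1 P1) (d1 : hom P1 L)
    (i2 : hom K2 P2) (d2 : hom P2 L) (S : short_exact i1 d1) :
  short_exact i2 d2 ->
  exists j, [/\ short_exact j (pb_map (pullback d2 S)), pb_map (pullback d2 S) ∘ j = 0
                & pb_def (pullback d2 S) ∘ j = i2].
Proof.
move=> S2; set pb := pullback d2 S.
have SS := cartesian_ses (pb_ses pb) S (pb_infE pb) (esym (pb_sq pb)).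
have [j j1 j2] : exists2 j, pb_map pb ∘ j = 0 & pb_def pb ∘ j = i2.
  by apply: pb_univ; rewrite compm0 (ses0 S2).
exists j; split=> //; apply: epi_ses.
  apply: epi0 => W u E; have [|v vE] := ses_desc (u := u ∘ prl _) SS.
    by rewrite -compA prl_pair.
  have v0 : v = 0.
    apply: (comp_eq0l (ses_epi S2)).
    have /(congr1 (fun w => w ∘ inr_ _)) := vE.
    rewrite -!compA copair_inr prl_inr compm0 compNr => /eqP.
    by rewrite oppr_eq0 => /eqP.
  have /(congr1 (fun w => w ∘ inl_ _)) := vE.
  by rewrite v0 comp0m comp0m -compA prl_inl compm1.
apply: kernelP => //.
  apply: mono0 => W u E; apply: (comp_eq0r (ses_mono S2)).
  by rewrite -j2 -compA E compm0.
move=> W w E; have [|y yE] := ses_lift (u := pb_def pb ∘ w) S2.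
  by rewrite compA -(pb_sq pb) -compA E compm0.
exists y; apply: (@pb_ext _ _ _ _ _ _ _ _ pb); rewrite compA ?j1 ?j2 //.
by rewrite comp0m E.
Qed.

End AbelianSquares.

(** * Yoneda products and the covariant long exact sequence *)

Section YonedaProducts.
Variables (A : abelian) (C : ext_closed A).
Implicit Types B K L M T X Y Z : C.

Lemma ymor_cls s B K B' K' (e : yseq s B K) (e' : yseq s B' K') f g :
  ymor e e' f g -> push f (cls (t := s.+1) e) = pull g (cls (t := s.+1) e').
Proof. by move=> h; rewrite pushE pullE; apply/yextP/ymor_eqv. Qed.

Lemma ymor_cls_push s B K K' (e : yseq s B K) (e' : yseq s B K') f :
  ymor e e' f (idm B) -> push f (cls (t := s.+1) e) = cls (t := s.+1) e'.
Proof. by move/ymor_cls; rewrite pull1. Qed.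

Lemma ymor_cls_pull s B B' K (e : yseq s B K) (e' : yseq s B' K) g :
  ymor e e' (idm K) g -> cls (t := s.+1) e = pull g (cls (t := s.+1) e').
Proof. by move/ymor_cls; rewrite push1. Qed.

Lemma mul1_push t B L K K' (f : hom K K') (x : Ext 1 L K) (y : Ext t B L) :
  push f (mul1 x y) = mul1 (push f x) y.
Proof.
case: t y => [|s] y; first exact: (push_pull (t := 1)).
have [c <-] := cls_surj x; have [e <-] := cls_surj y.
by rewrite (pushE (s := 0)) !mul1E (pushE (s := s.+1)).
Qed.

Lemma mul1_pull t B L L' K (h : hom L L') (x : Ext 1 L' K) (y : Ext t B L) :
  mul1 (pull h x) y = mul1 x (push h y).
Proof.
case: t y => [|s] y; first exact: (pull_comp (t := 1)).
have [c <-] := cls_surj x; have [e <-] := cls_surj y.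
rewrite (pullE (s := 0)) pushE !mul1E; apply/yextP/rst_step; exists h.
by split; [exact: conf_pullP|exact: ypushP].
Qed.

Lemma mul1_addr t B L K (x : Ext 1 L K) (y y' : Ext t B L) :
  mul1 x (y + y') = mul1 x y + mul1 x y'.
Proof.
case: t y y' => [|s] y y'; first exact: (pull_addl (t := 1)).
have [c <-] := cls_surj x; have [e <-] := cls_surj y; have [e' <-] := cls_surj y'.
rewrite [cls e + _]addE (mul1E c e) (mul1E c e') addE /ybaer -!pushE -!pullE -mul1_pull.
rewrite -(@ymor_cls 0 (ex_dsum L L) (ex_dsum K K) _ _ (conf_sum c c) c (codiagm K) (codiagm L));
  last exact: (@ysum_codiag _ _ 0).
by rewrite -mul1_push pullE mul1E pullE.
Qed.

Lemma mul1_addl t B L K (x x' : Ext 1 L K) (y : Ext t B L) :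
  mul1 (x + x') y = mul1 x y + mul1 x' y.
Proof.
case: t y => [|s] y; first exact: (pull_addr (t := 1)).
have [c <-] := cls_surj x; have [c' <-] := cls_surj x'; have [e <-] := cls_surj y.
rewrite [cls c + _](addE (s := 0)) (mul1E c e) (mul1E c' e) addE /ybaer -!pushE -!pullE.
rewrite -mul1_push mul1_pull.
rewrite (@ymor_cls s B L (ex_dsum B B) (ex_dsum L L) e (ysum e e) (diagm L) (diagm B));
  last exact: ysum_diag.
by rewrite pullE mul1E pullE.
Qed.

Lemma mul1_0r t B L K (x : Ext 1 L K) : mul1 x (0 : Ext t B L) = 0.
Proof. by apply: (addrI (mul1 x 0)); rewrite -mul1_addr !addr0. Qed.

Lemma mul1_0l t B L K (y : Ext t B L) : mul1 (0 : Ext 1 L K) y = 0.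
Proof. by apply: (addrI (mul1 0 y)); rewrite -mul1_addl !addr0. Qed.

Lemma mul1_Nr t B L K (x : Ext 1 L K) (y : Ext t B L) : mul1 x (- y) = - mul1 x y.
Proof. by apply: (addrI (mul1 x y)); rewrite -mul1_addr !subrr mul1_0r. Qed.

Lemma mul1_Br t B L K (x : Ext 1 L K) (y y' : Ext t B L) :
  mul1 x (y - y') = mul1 x y - mul1 x y'.
Proof. by rewrite mul1_addr mul1_Nr. Qed.

Lemma mul1_Nl t B L K (x : Ext 1 L K) (y : Ext t B L) : mul1 (- x) y = - mul1 x y.
Proof. by apply: (addrI (mul1 x y)); rewrite -mul1_addl !subrr mul1_0l. Qed.

Lemma mul1_Bl t B L K (x x' : Ext 1 L K) (y : Ext t B L) :
  mul1 (x - x') y = mul1 x y - mul1 x' y.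
Proof. by rewrite mul1_addl mul1_Nl. Qed.

Lemma push_Br t B K K' (f : hom K K') (x y : Ext t B K) :
  push f (x - y) = push f x - push f y.
Proof. by rewrite push_addr push_Nr. Qed.

Lemma push_Bl t B K K' (f f' : hom K K') (x : Ext t B K) :
  push (f - f') x = push f x - push f' x.
Proof. by rewrite push_addl push_Nl. Qed.

Lemma mul1_surj t B K (x : Ext t.+1 B K) :
  exists L (c : conflation L K) (y : Ext t B L), x = mul1 (cls (t := 1) c) y.
Proof.
have [e <-] := cls_surj x; case: t x e => [|s] x e.
  by exists B, e, (idm B); rewrite /mul1 (pull1 (t := 1)).
case: e => L [c e]; exists L, c, (cls (t := s.+1) e); by rewrite mul1E.
Qed.

(** * Split conflations and exactness in degree one *)

(** Splitting is invariant under morphisms with fixed ends: sections are carried forwards by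
    composition, retractions backwards. *)
Lemma cls_eq0P L K (c : conflation L K) :
  cls (t := 1) c = 0 <-> exists s : hom L (mid c), defl c ∘ s = idm L.
Proof.
pose sec (c : conflation L K) := exists s : hom L (mid c), defl c ∘ s = idm L.
have secE (c1 c2 : conflation L K) : fixed_ends (s := 0) c1 c2 -> sec c1 <-> sec c2.
  move=> [h [h1 h2]]; rewrite compm1 in h1; rewrite comp1m in h2; split.
    by move=> [s sE]; exists (h ∘ s); rewrite compA -h2.
  move=> /(retraction_section (conf_ses c2))[r rE].
  apply/(retraction_section (conf_ses c1)); exists (r ∘ h).
  by rewrite -compA h1.
have yE (c1 c2 : conflation L K) : yeqv (s := 0) c1 c2 -> sec c1 <-> sec c2.
  elim=> {c1 c2} [c1 c2 /secE //|//|c1 c2 _ -> //|c1 c2 c3 _ -> _ -> //].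
split=> [/(yextP (s := 0))/yE E|/(retraction_section (conf_ses c))[r rE]].
  by apply/E; exists (inr_ (dsum K L)); exact: prr_inr.
apply/(yextP (s := 0))/rst_step; exists (pair_ r (defl c)); split=> /=.
  by rewrite pair_comp rE (ses0 (conf_ses c)) compm1 /pair_ compm0 addr0 compm1.
by rewrite comp1m prr_pair.
Qed.

Lemma pull_defl_cls L K (c : conflation L K) : pull (defl c) (cls (t := 1) c) = 0.
Proof.
rewrite (pullE (s := 0)); apply/cls_eq0P.
have [v _ vE] := pb_univ (pullback (defl c) (conf_ses c)) (erefl (defl c ∘ idm _)).
by exists v.
Qed.

Lemma push_infl_cls L K (c : conflation L K) : push (infl c) (cls (t := 1) c) = 0.
Proof.
rewrite (pushE (s := 0)); apply/cls_eq0P/(retraction_section (conf_ses _)).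
have [v _ vE] := po_univ (pushout (infl c) (conf_ses c)) (erefl (idm _ ∘ infl c)).
by exists v.
Qed.

(* If [x] is the class of [c0], a retraction of the push-out of [c0] gives a map
   [mid c0 -> L] extending [defl c]; its kernel is the middle term of [w]. *)
Lemma push_defl_exact1 L L0 K (c : conflation L K) (x : Ext 1 L0 (mid c)) :
  push (defl c) x = 0 -> exists w, x = push (infl c) w.
Proof.
have [c0 <-] := cls_surj x.
rewrite (pushE (s := 0)) => /cls_eq0P/(retraction_section (conf_ses _))[r rE].
set po := pushout (defl c) (conf_ses c0) in r rE; rewrite /= in rE.
have hE : (r ∘ po_map po) ∘ infl c0 = defl c.
  by rewrite -compA po_sq compA [r ∘ _]rE comp1m.
move: (r ∘ po_map po) hE => h hE {r rE po}.
have [W [k kW]] := has_kernel h.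
have eh : is_epi h.
  by apply: epi0 => Z u E; apply: (comp_eq0l (ses_epi (conf_ses c))); rewrite -hE compA E comp0m.
have Sh := epi_ses eh kW.
have [j jE] : exists j, k ∘ j = infl c0 ∘ infl c.
  by apply: (ses_lift Sh); rewrite compA hE (ses0 (conf_ses c)).
have Sw : short_exact j (defl c0 ∘ k).
  apply: epi_ses.
    apply: epi0 => Z u; rewrite compA => /(ses_desc Sh)[v vE].
    have v0 : v = 0.
      apply: (comp_eq0l (ses_epi (conf_ses c))).
      by rewrite -hE compA vE -compA (ses0 (conf_ses c0)) compm0.
    by apply: (comp_eq0l (ses_epi (conf_ses c0))); rewrite -vE v0 comp0m.
  apply: kernelP.
  - by rewrite -compA jE compA (ses0 (conf_ses c0)) comp0m.
  - apply: mono0 => Z u E.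
    apply: (comp_eq0r (mono_comp (ses_mono (conf_ses c)) (ses_mono (conf_ses c0)))).
    by rewrite -jE -compA E compm0.
  - move=> Z u; rewrite -compA => /(ses_lift (conf_ses c0))[v vE].
    have [|w wE] := ses_lift (u := v) (conf_ses c).
      by rewrite -hE -compA vE compA (ses0 Sh) comp0m.
    exists w; apply: (ses_mono Sh).
    by rewrite compA jE -compA wE vE.
pose w := @Conflation A C L0 K (ExObj (ex_ext Sw (ex_valP K) (ex_valP L0))) _ _ Sw.
exists (cls (t := 1) w); apply/esym/(ymor_cls_push (s := 0)); exists k.
by rewrite comp1m.
Qed.

(** Dual to [push_defl_exact1]: a section of the pull-back lifts [infl c] to a map into [mid c0],
    and the cokernel of this lift is the middle term of [w]. *)
Lemma pull_infl_exact1 L K T (c : conflation L K) (x : Ext 1 (mid c) T) :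
  pull (infl c) x = 0 -> exists w, x = pull (defl c) w.
Proof.
have [c0 <-] := cls_surj x.
rewrite (pullE (s := 0)) => /cls_eq0P[r rE].
set pb := pullback (infl c) (conf_ses c0) in r rE; rewrite /= in rE.
have hE : defl c0 ∘ (pb_map pb ∘ r) = infl c.
  by rewrite compA pb_sq -compA [_ ∘ r]rE compm1.
move: (pb_map pb ∘ r) hE => h hE {r rE pb}.
have [W [k kW]] := has_cokernel h.
have eh : is_mono h.
  by apply: mono0 => Z u E; apply: (comp_eq0r (ses_mono (conf_ses c))); rewrite -hE -compA E compm0.
have Sh := mono_ses eh kW.
have [j jE] : exists j, j ∘ k = defl c ∘ defl c0.
  by apply: (ses_desc Sh); rewrite -compA hE (ses0 (conf_ses c)).
have Sw : short_exact (k ∘ infl c0) j.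
  apply: mono_ses.
    apply: mono0 => Z u; rewrite -compA => /(ses_lift Sh)[v vE].
    have v0 : v = 0.
      apply: (comp_eq0r (ses_mono (conf_ses c))).
      by rewrite -hE -compA vE compA (ses0 (conf_ses c0)) comp0m.
    by apply: (comp_eq0r (ses_mono (conf_ses c0))); rewrite -vE v0 compm0.
  apply: cokernelP.
  - by rewrite compA jE -compA (ses0 (conf_ses c0)) compm0.
  - apply: epi0 => Z u E.
    apply: (comp_eq0l (epi_comp (ses_epi (conf_ses c0)) (ses_epi (conf_ses c)))).
    by rewrite -jE compA E comp0m.
  - move=> Z u; rewrite compA => /(ses_desc (conf_ses c0))[v vE].
    have [|w wE] := ses_desc (u := v) (conf_ses c).
      by rewrite -hE compA vE -compA (ses0 Sh) compm0.
    exists w; apply: (ses_epi Sh).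
    by rewrite -compA jE compA wE vE.
pose w := @Conflation A C L T (ExObj (ex_ext Sw (ex_valP T) (ex_valP L))) _ _ Sw.
exists (cls (t := 1) w); apply/(ymor_cls_pull (s := 0)); exists k.
by rewrite compm1.
Qed.

(** A retraction of the push-out extends [infl c] over [mid c0]; [h] is the map induced on
    cokernels. *)
Lemma push_infl_exact1 L L0 K (c : conflation L K) (x : Ext 1 L0 K) :
  push (infl c) x = 0 -> exists h : hom L0 L, x = pull h (cls (t := 1) c).
Proof.
have [c0 <-] := cls_surj x.
rewrite (pushE (s := 0)) => /cls_eq0P/(retraction_section (conf_ses _))[r rE].
set po := pushout (infl c) (conf_ses c0) in r rE; rewrite /= in rE.
have hE : (r ∘ po_map po) ∘ infl c0 = infl c.
  by rewrite -compA po_sq compA [r ∘ _]rE comp1m.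
have [|h hh] := ses_desc (u := defl c ∘ (r ∘ po_map po)) (conf_ses c0).
  by rewrite -compA hE (ses0 (conf_ses c)).
exists h; apply: (ymor_cls_pull (s := 0)); exists (r ∘ po_map po).
by rewrite compm1.
Qed.

Section CovariantExactness.
Variable s : nat.

(** Exactness at the middle term in one degree, supplied by the induction in [push_defl_exact]. It
    is quantified over all conflations because it gets applied to an auxiliary one. *)
Hypothesis exact_s : forall B L K (c : conflation L K) (x : Ext s.+1 B (mid c)),
  push (defl c) x = 0 -> exists w, x = push (infl c) w.

(* Liftability of [y] along [defl c] is invariant under the moves generating the
   equivalence of extensions [c y]. *)
Lemma mul1_cls_exact_step B L K (c : conflation L K) (y : Ext s.+1 B L) :
  mul1 (cls (t := 1) c) y = 0 -> exists z, y = push (defl c) z.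
Proof.
pose liftable L (c : conflation L K) (y : yseq s B L) :=
  exists z : Ext s.+1 B (mid c), cls (t := s.+1) y = push (defl c) z.
pose lifts (e : yseq s.+1 B K) := liftable _ (projT2 e).1 (projT2 e).2.
have step e1 e2 : fixed_ends e1 e2 -> lifts e1 <-> lifts e2.
  move: e1 e2 => [L1 [c1 y1]] [L2 [c2 y2]] [k /= [[h [h1 h2]] yk]].
  rewrite compm1 in h1; have {}yk := ymor_cls_push yk; rewrite /lifts /=; split=> -[z zE].
    exists (push (K' := mid c2) h z).
    by rewrite push_comp -h2 -push_comp -zE.
  (* Backwards, the pair of [z] and [y1] is killed by the deflation of [cc]. It therefore comes from
     a class with values in [mid c1], and the [L1] component of that equation lifts [y1]. *)
  have SS := cartesian_ses (conf_ses c1) (conf_ses c2) h1 h2.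
  pose cc := @Conflation A C L2 (mid c1) (ex_dsum (mid c2) L1) _ _ SS.
  have dl : defl cc ∘ inl_ (dsum (mid c2) L1) = defl c2 by exact: copair_inl.
  have dr : defl cc ∘ inr_ (dsum (mid c2) L1) = - k by exact: copair_inr.
  have il : prr (dsum (mid c2) L1) ∘ infl cc = defl c1 by exact: prr_pair.
  have [|w wE] := @exact_s B L2 (mid c1) cc (push (K' := ex_dsum (mid c2) L1) (inl_ _) z
      + push (K' := ex_dsum (mid c2) L1) (inr_ _) (cls (t := s.+1) y1)).
    by rewrite push_addr !push_comp dl dr -zE -yk -push_addl subrr push_0l.
  exists w; have /(congr1 (push (K := ex_dsum (mid c2) L1) (K' := L1)
    (prr (dsum (mid c2) L1)))) := wE.
  by rewrite push_addr !push_comp prr_inl prr_inr il push_0l add0r push1.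
have yE e1 e2 : yeqv e1 e2 -> lifts e1 <-> lifts e2.
  elim=> {e1 e2} [e1 e2 /step //|//|e1 e2 _ -> //|e1 e2 e3 _ -> _ -> //].
have [e <-] := cls_surj y; rewrite (mul1E c) => /yextP/yE E.
suff: lifts (ymul1 (t := s.+1) c e) by [].
by apply/E; exists 0; rewrite push_0r.
Qed.

End CovariantExactness.

(** Write [x] as [c0 y] and let [c1] be [c0] pushed along [defl c]. From [c1 y = 0], [y] lifts along
    [defl c1] to some [z], so [x] is [c0] pulled back along [defl c1], times [z]; pushing this
    degree-one factor along [defl c] gives zero, and the degree-one case finishes. *)
Lemma push_defl_exact t B L K (c : conflation L K) (x : Ext t B (mid c)) :
  push (defl c) x = 0 -> exists w, x = push (infl c) w.
Proof.
elim/ltn_ind: t => -[_|[_|s IH]] in B L K c x *.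
- by move=> /(ses_lift (conf_ses c))[w wE]; exists w.
- exact: push_defl_exact1.
have [L0 [c0 [y ->]]] := mul1_surj x.
rewrite mul1_push; have [c1 c1E] := cls_surj (push (defl c) (cls (t := 1) c0)).
rewrite -c1E => /(mul1_cls_exact_step (fun B L K c => IH s.+1 (ltnSn _) B L K c))[z ->].
rewrite -mul1_pull.
have [|w ->] := @push_defl_exact1 _ _ _ c (pull (defl c1) (cls (t := 1) c0)).
  by rewrite push_pull -c1E pull_defl_cls.
by exists (mul1 w z); rewrite mul1_push.
Qed.

Lemma mul1_cls_exact t B L K (c : conflation L K) (y : Ext t B L) :
  mul1 (cls (t := 1) c) y = 0 -> exists z, y = push (defl c) z.
Proof.
case: t y => [|s] y; last by apply: mul1_cls_exact_step => *; exact: push_defl_exact.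
rewrite /mul1 (pullE (s := 0)) => /cls_eq0P[r rE].
set pb := pullback y (conf_ses c) in r rE; rewrite /= in rE.
by exists (pb_map pb ∘ r); rewrite /= compA pb_sq -compA [_ ∘ r]rE compm1.
Qed.

Lemma push_infl_exact t B L K (c : conflation L K) (x : Ext t.+1 B K) :
  push (infl c) x = 0 -> exists y, x = mul1 (cls (t := 1) c) y.
Proof.
case: t x => [|s] x; first exact: push_infl_exact1.
have [L0 [c0 [y ->]]] := mul1_surj x.
rewrite mul1_push; have [c1 c1E] := cls_surj (push (infl c) (cls (t := 1) c0)).
rewrite -c1E => /mul1_cls_exact[z ->]; rewrite -mul1_pull.
have [|h ->] := @push_infl_exact1 _ _ _ c (pull (defl c1) (cls (t := 1) c0)).
  by rewrite push_pull -c1E pull_defl_cls.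
by exists (push h z); rewrite mul1_pull.
Qed.

End YonedaProducts.

(** * The contravariant long exact sequence *)

Section RightProducts.
Variables (A : abelian) (C : ext_closed A).
Implicit Types B K L M T X Y Z : C.

(** Sequences are listed from the left, so adding a conflation at the right end is recursive; [rdec]
    inverts it by detaching the rightmost conflation. *)
Fixpoint rsplice s B L K : yseq s L K -> conflation B L -> yseq s.+1 B K :=
  match s with
  | 0 => fun x c => splice (s := 0) x c
  | s'.+1 => fun x c => splice (projT2 x).1 (rsplice (projT2 x).2 c)
  end.

Fixpoint rdec s B K : yseq s.+1 B K -> {L : C & yseq s L K * conflation B L}%type :=
  match s with
  | 0 => fun e => e
  | s'.+1 => fun e => let d := rdec (projT2 e).2 in
      existT _ (projT1 d) (splice (projT2 e).1 (projT2 d).1, (projT2 d).2)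
  end.

Lemma rdecK s B K (e : yseq s.+1 B K) :
  rsplice (projT2 (rdec e)).1 (projT2 (rdec e)).2 = e.
Proof.
elim: s => [|s IH] in B K e *; first by case: e => L [].
by case: e => L [c e]; rewrite -[in RHS](IH _ _ e).
Qed.

Lemma rspliceK s B L K (x : yseq s L K) (c : conflation B L) :
  rdec (rsplice x c) = existT _ L (x, c).
Proof.
elim: s => [|s IH] in B L K x c *; first by [].
by case: x => L' [c' x]; rewrite [LHS]/= IH.
Qed.

Lemma ymor_rsplice s B L K B' L' K' (x : yseq s L K) (c : conflation B L)
    (x' : yseq s L' K') (c' : conflation B' L') f k g :
  ymor x x' f k -> conf_mor c c' k g -> ymor (rsplice x c) (rsplice x' c') f g.
Proof.
elim: s => [|s IH] in B L K B' L' K' x c x' c' f k g *; first by exists k.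
by move=> [l [h1 h2]] h; exists l; split; last exact: IH h2 h.
Qed.

Lemma ymor_rdec s B K B' K' (e : yseq s.+1 B K) (e' : yseq s.+1 B' K') f g :
  ymor e e' f g -> exists k,
    ymor (projT2 (rdec e)).1 (projT2 (rdec e')).1 f k /\
    conf_mor (projT2 (rdec e)).2 (projT2 (rdec e')).2 k g.
Proof.
elim: s => [|s IH] in B K B' K' e e' f g *; first by [].
by move=> [l [h1 /IH[k [h2 h3]]]]; exists k; split=> //; exists l.
Qed.

Definition rmul s B L K (x : Ext s.+1 L K) (c : Ext 1 B L) : Ext s.+2 B K :=
  cls (t := s.+2) (rsplice (repr (x : yext s L K)) (repr (c : yext 0 B L))).

Lemma rmulE s B L K (x : yseq s L K) (c : conflation B L) :
  rmul (cls (t := s.+1) x) (cls (t := 1) c) = cls (t := s.+2) (rsplice x c).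
Proof.
have H (y y' : yseq s L K) (d d' : conflation B L) : yeqv y y' -> yeqv (s := 0) d d' ->
    yeqv (rsplice y d) (rsplice y' d').
  move=> h1 h2; apply: (@yeqv_trans _ _ _ _ _ (rsplice y' d)).
    apply: (yeqv_lift (F := fun e => rsplice e d)) h1 => e e' h.
    by apply/rst_step/(ymor_rsplice h)/(ymor_id (s := 0)).
  apply: (yeqv_lift (s := 0) (F := rsplice y')) h2 => e e' h.
  exact/rst_step/(ymor_rsplice (ymor_id _) h).
by apply/yextP/H; exact: yext_repr.
Qed.

Lemma rmul_surj s B K (x : Ext s.+2 B K) :
  exists L (y : Ext s.+1 L K) (c : conflation B L), x = rmul y (cls (t := 1) c).
Proof.
have [e <-] := cls_surj x; exists (projT1 (rdec e)).
exists (cls (t := s.+1) (projT2 (rdec e)).1), (projT2 (rdec e)).2.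
by rewrite rmulE rdecK.
Qed.

Lemma push_rmul s B L K K' (f : hom K K') (x : Ext s.+1 L K) (c : Ext 1 B L) :
  push f (rmul x c) = rmul (push f x) c.
Proof.
have [e <-] := cls_surj x; have [d <-] := cls_surj c.
rewrite pushE !rmulE; apply: ymor_cls_push.
exact: ymor_rsplice (ypushP _ _) (ymor_id (s := 0) _).
Qed.

Lemma pull_rmul s B B' L K (g : hom B' B) (x : Ext s.+1 L K) (c : Ext 1 B L) :
  pull g (rmul x c) = rmul x (pull g c).
Proof.
have [e <-] := cls_surj x; have [d <-] := cls_surj c.
rewrite (pullE (s := 0)) !rmulE; apply/esym/ymor_cls_pull.
exact: ymor_rsplice (ymor_id _) (conf_pullP _ _).
Qed.

Lemma rmul_pull s B L L' K (h : hom L L') (x : Ext s.+1 L' K) (c : Ext 1 B L) :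
  rmul (pull h x) c = rmul x (push h c).
Proof.
have [e <-] := cls_surj x; have [d <-] := cls_surj c.
rewrite pullE (pushE (s := 0)) !rmulE; apply/yextP/rst_step.
exact: ymor_rsplice (ypullP _ _) (conf_pushP _ _).
Qed.

Section ContravariantExactness.
Variable s : nat.

Hypothesis exact_s : forall L K T (c : conflation L K) (x : Ext s.+1 (mid c) T),
  pull (infl c) x = 0 -> exists w, x = pull (defl c) w.

(** Dual to [mul1_cls_exact_step]: extendability along the inflation of the rightmost conflation is
    invariant under the moves generating the equivalence. *)
Lemma rmul_cls_exact_step B L K (c : conflation B L) (x : Ext s.+1 L K) :
  rmul x (cls (t := 1) c) = 0 -> exists z, x = pull (infl c) z.
Proof.
pose extendable L (y : yseq s L K) (c : conflation B L) :=
  exists z : Ext s.+1 (mid c) K, cls (t := s.+1) y = pull (infl c) z.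
pose extends (e : yseq s.+1 B K) := extendable _ (projT2 (rdec e)).1 (projT2 (rdec e)).2.
have step e1 e2 : fixed_ends e1 e2 -> extends e1 <-> extends e2.
  move=> /ymor_rdec; rewrite /extends.
  case: (rdec e1) (rdec e2) => [L1 [y1 c1]] [L2 [y2 c2]] /= [k [yk [h [h1 h2]]]].
  rewrite comp1m in h2; have {}yk := ymor_cls_pull yk; split=> -[z zE]; last first.
    exists (pull (B' := mid c1) h z).
    by rewrite pull_comp h1 -pull_comp -zE.
  have SS := cocartesian_ses (conf_ses c1) (conf_ses c2) (esym h2) h1.
  pose cc := @Conflation A C (mid c2) L1 (ex_dsum (mid c1) L2) _ _ SS.
  have dl : prl (dsum (mid c1) L2) ∘ infl cc = infl c1 by exact: prl_pair.
  have dr : prr (dsum (mid c1) L2) ∘ infl cc = - k by exact: prr_pair.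
  have il : defl cc ∘ inr_ (dsum (mid c1) L2) = infl c2 by exact: copair_inr.
  have [|w wE] := @exact_s (mid c2) L1 K cc (pull (B' := ex_dsum (mid c1) L2) (prl _) z
      + pull (B' := ex_dsum (mid c1) L2) (prr _) (cls (t := s.+1) y2)).
    by rewrite pull_addr !pull_comp dl dr -zE yk -pull_addl subrr pull_0l.
  exists w; have /(congr1 (pull (B := ex_dsum (mid c1) L2) (B' := L2)
    (inr_ (dsum (mid c1) L2)))) := wE.
  by rewrite pull_addr !pull_comp prl_inr prr_inr il pull_0l add0r pull1.
have yE e1 e2 : yeqv e1 e2 -> extends e1 <-> extends e2.
  elim=> {e1 e2} [e1 e2 /step //|//|e1 e2 _ -> //|e1 e2 e3 _ -> _ -> //].
have [e <-] := cls_surj x => E0.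
(* Zero is presented as a splice ending in [c], so that [rspliceK] applies on both sides. *)
have: rmul (cls (t := s.+1) e) (cls (t := 1) c) =
    rmul (cls (t := s.+1) (ypush (0 : hom K K) e)) (cls (t := 1) c).
  by rewrite -pushE -push_rmul push_0l.
rewrite !rmulE => /yextP/yE.
rewrite /extends !rspliceK => E; apply/E; exists 0.
by rewrite pull_0r -pushE push_0l.
Qed.

End ContravariantExactness.

Lemma pull_infl_exact s L K T (c : conflation L K) (x : Ext s.+1 (mid c) T) :
  pull (infl c) x = 0 -> exists w, x = pull (defl c) w.
Proof.
elim: s => [|s IH] in L K T c x *; first exact: pull_infl_exact1.
have [L0 [y [c0 ->]]] := rmul_surj x.
rewrite pull_rmul; have [c1 c1E] := cls_surj (pull (infl c) (cls (t := 1) c0)).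
rewrite -c1E => /(rmul_cls_exact_step IH)[z ->].
rewrite rmul_pull.
have [|w ->] := @pull_infl_exact1 _ _ _ _ _ c (push (infl c1) (cls (t := 1) c0)).
  by rewrite -push_pull -c1E push_infl_cls.
by exists (rmul z w); rewrite pull_rmul.
Qed.

Lemma rmul_cls_exact s B L K (c : conflation B L) (x : Ext s.+1 L K) :
  rmul x (cls (t := 1) c) = 0 -> exists z, x = pull (infl c) z.
Proof. by apply: rmul_cls_exact_step => *; exact: pull_infl_exact. Qed.

(** * Products of a sequence with a class *)

Fixpoint mulseq s t B L K : yseq s L K -> Ext t B L -> Ext (s + t).+1 B K :=
  match s with
  | 0 => fun x y => mul1 (cls (t := 1) x) y
  | s'.+1 => fun x y => mul1 (cls (t := 1) (projT2 x).1) (mulseq (projT2 x).2 y)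
  end.

Lemma mulseq_ymor s t B L K L' K' (x : yseq s L K) (x' : yseq s L' K') f g (y : Ext t B L) :
  ymor x x' f g -> push f (mulseq x y) = mulseq x' (push g y).
Proof.
elim: s => [|s IH] in L K L' K' x x' f g y *.
  by move=> /(ymor_cls (s := 0)) E; rewrite [LHS]mul1_push E; exact: mul1_pull.
move=> [k [/(ymor_cls (s := 0)) h1 /IH h2]].
by rewrite [LHS]mul1_push h1 mul1_pull h2.
Qed.

Lemma mulseq_eqv s t B L K (x x' : yseq s L K) (y : Ext t B L) :
  yeqv x x' -> mulseq x y = mulseq x' y.
Proof.
elim=> {x x'} [x x' /(mulseq_ymor y)|//|//|x x' x'' _ -> //].
by rewrite !push1.
Qed.

Lemma mulseq_eq0 s t B L K (x : yseq s L K) (y : Ext t B L) :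
  cls (t := s.+1) x = 0 -> mulseq x y = 0.
Proof.
move=> x0; have : cls (t := s.+1) x = cls (t := s.+1) (ypush (0 : hom K K) x).
  by rewrite x0 -pushE push_0l.
move=> /yextP/mulseq_eqv ->.
by have := mulseq_ymor y (ypushP (0 : hom K K) x); rewrite push1 push_0l => <-.
Qed.

(** Equality in this sigma type compares classes whose degrees are only provably equal, without
    casts. *)
Definition graded B K := {t : nat & Ext t B K}.
Definition homog t B K (x : Ext t B K) : graded B K := existT _ t x.

Lemma homog_eq0 B K t t' (x : Ext t B K) (x' : Ext t' B K) :
  homog x = homog x' -> x = 0 -> x' = 0.
Proof.
move=> /(congr1 (fun u : graded B K => projT2 u = 0)) /= E x0.
by move: E; rewrite x0 => <-.
Qed.

Lemma homog_mul1 B L K (c : Ext 1 L K) t t' (x : Ext t B L) (x' : Ext t' B L) :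
  homog x = homog x' -> homog (mul1 c x) = homog (mul1 c x').
Proof. by move=> /(congr1 (fun u : graded B L => homog (mul1 c (projT2 u)))). Qed.

(* Associativity: the two sides have degrees [(s + t.+1).+1] and [(s.+1 + t).+1],
   which are equal but not convertible. *)
Lemma mulseq_rsplice s t B L L' K (x : yseq s L K) (c : conflation L' L) (y : Ext t B L') :
  homog (mulseq x (mul1 (cls (t := 1) c) y)) = homog (mulseq (rsplice x c) y).
Proof.
elim: s => [|s IH] in L K x c *; first by [].
exact: homog_mul1 (IH _ _ _ _).
Qed.

Lemma mulseq_idm s L K (x : yseq s L K) :
  homog (mulseq x (idm L : Ext 0 L L)) = homog (cls (t := s.+1) x).
Proof.
elim: s => [|s IH] in L K x *; first by congr homog; exact: (pull1 (t := 1)).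
case: x => L' [c x]; rewrite -[cls _](mul1E c (x : extension s.+1 L L')).
exact: homog_mul1 (IH _ _ _).
Qed.

End RightProducts.

(** * [n]-Frobenius categories *)

Section FrobeniusTheory.
Variables (A : abelian) (C : ext_closed A) (n : nat).
Implicit Types K L M N P R S T X Y Z : C.
Hypothesis hC : nFrobenius C n.

Local Notation inP := (@nproj_sub A C n _ _).

(** This is where the coincidence of [n]-projectives and [n]-injectives enters. *)
Lemma nproj_injective P t X (x : Ext t X P) : nproj n P -> (n < t)%N -> x = 0.
Proof. by case: hC => _ _ H /H I nt; apply: I. Qed.

(** A class on [S] of degree above [n] becomes zero when multiplied by [c], so it is the restriction
    of a class on [mid c], which vanishes. *)
Lemma nproj_kernel R S (c : conflation R S) :
  nproj n (mid c) -> nproj n R -> nproj n S.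
Proof.
move=> hQ hR [//|s] ns X x.
have [|z ->] := @rmul_cls_exact _ _ _ _ _ _ c x; first by apply: hR; exact: ltnW.
by rewrite [z]hQ // pull_0r.
Qed.

Lemma nproj_mid R S (c : conflation R S) :
  nproj n S -> nproj n R -> nproj n (mid c).
Proof.
move=> hS hR [//|s] ns X x.
have [|z ->] := @pull_infl_exact _ _ _ _ _ _ c x; first exact: hS.
by rewrite [z]hR // pull_0r.
Qed.

Lemma nproj_deflation X : exists K (c : conflation X K), nproj n (mid c).
Proof.
case: hC => H _ _; have [K [P [i [p [hP S]]]]] := H X.
by exists K, (Conflation S).
Qed.

(** Compose an [n]-projective deflation onto [mid c] with [defl c]: the kernel of the composite is
    the pull-back along [infl c], which maps to [K]. *)
Lemma nproj_cover L K (c : conflation L K) :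
  exists K' (e : conflation L K') (g : hom K' K),
    nproj n (mid e) /\ push g (cls (t := 1) e) = cls (t := 1) c.
Proof.
have [S0 [q hq]] := nproj_deflation (mid c).
have Sw := pullback_infl_ses (conf_ses q) (conf_ses c).
pose r := conf_pull (infl c) q.
exists (mid r), (@Conflation A C L (mid r) (mid q) _ _ Sw), (defl r); split=> //.
apply: (ymor_cls_push (s := 0)); exists (defl q); split; first exact: pb_sq.
exact: comp1m.
Qed.

Lemma nproj_conf_pull X Y K (b : hom X Y) (e : conflation Y K) :
  nproj_inflation n b -> nproj n (mid e) -> nproj n (mid (conf_pull b e)).
Proof.
move=> [P [p [hP S]]] he.
have Sw := pullback_infl_ses (conf_ses e) S.
exact: (@nproj_kernel P _ (@Conflation A C P (mid (conf_pull b e)) (mid e) _ _ Sw)).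
Qed.

Lemma nproj_conf_push L K K' (j : hom K K') (e : conflation L K) :
  nproj_inflation n j -> nproj n (mid e) -> nproj n (mid (conf_push j e)).
Proof.
move=> [P [p [hP S]]] he.
have [q Sq] := pushout_infl_ses (conf_ses e) S.
exact: (@nproj_mid P _ (@Conflation A C P (mid e) (mid (conf_push j e)) _ _ Sq)).
Qed.

Lemma nproj_inflation_idm X : nproj_inflation n (idm X).
Proof. by exists (ex_ob0 C), 0; split; [exact: nproj_ob0|exact: id0_ses]. Qed.

Lemma nproj_inflationN X Y (a : hom X Y) : nproj_inflation n a -> nproj_inflation n (- a).
Proof.
move=> [P [p [hP S]]]; exists P, p; split=> //; apply: epi_ses; first exact: ses_epi S.
apply: kernelP; first by rewrite compNr (ses0 S) oppr0.
  by move=> Z u v; rewrite !compNl => /oppr_inj /(ses_mono S).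
move=> Z u /(ses_lift S)[v vE]; exists (- v).
by rewrite compNl compNr opprK.
Qed.

Lemma nproj_inflation_comp X Y Z (j : hom X Y) (k : hom Y Z) :
  nproj_inflation n j -> nproj_inflation n k -> nproj_inflation n (k ∘ j).
Proof.
move=> [P [p [hP S]]] [Q [q [hQ T]]].
pose c := @Conflation A C Q Y Z k q T.
exists (mid (conf_push p c)), (po_map (pushout p T)).
by split; [exact: nproj_mid|exact: pushout_defl_ses].
Qed.

Lemma nproj_inflation_pushout X Y Y' (j : hom X Y) (j' : hom X Y') :
  nproj_inflation n j -> nproj_inflation n j' ->
  exists Z (k : hom Y Z) (k' : hom Y' Z),
    [/\ nproj_inflation n k, nproj_inflation n k' & k ∘ j = k' ∘ j'].
Proof.
move=> [P [p [hP S]]] [P' [p' [hP' S']]].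
pose c := @Conflation A C P X Y j p S.
have [q Sq] := pushout_infl_ses S S'.
exists (mid (conf_push j' c)), (po_map (pushout j' S)), (po_inf (pushout j' S)).
split; last exact: po_sq.
  by exists P', q.
by exists P, (po_def (pushout j' S)); split=> //; exact: po_ses.
Qed.

(* Schanuel: both sides are the class of [K -> mid c1 + mid c2 -> L], where [K] is
   the pull-back of the two deflations. *)
Lemma nproj_schanuel L K1 K2 (c1 : conflation L K1) (c2 : conflation L K2) :
  nproj n (mid c1) -> nproj n (mid c2) ->
  exists K (j1 : hom K1 K) (j2 : hom K2 K),
    [/\ nproj_inflation n j1, nproj_inflation n j2
      & push j1 (cls (t := 1) c1) = push j2 (cls (t := 1) c2)].
Proof.
move=> h1 h2; pose pb := pullback (defl c2) (conf_ses c1).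
have [j [Sj j1 j2]] := pullback_defl_ses (conf_ses c1) (conf_ses c2).
pose K := mid (conf_pull (defl c2) c1).
have SS := cartesian_ses (pb_ses pb) (conf_ses c1) (pb_infE pb) (esym (pb_sq pb)).
pose cs := @Conflation A C L K (ex_dsum (mid c1) (mid c2)) _ _ SS.
(* The deflation of [cs] is [- defl c2] on the second summand, so the inclusion of [mid c2] induces
   [- idm L] on the right end; the sign on [j] compensates. *)
exists K, (pb_inf pb), (- j); split.
- by exists (mid c2), (pb_def pb); split=> //; exact: pb_ses.
- by apply: nproj_inflationN; exists (mid c1), (pb_map pb).
have -> : push (pb_inf pb : hom K1 K) (cls (t := 1) c1) = cls (t := 1) cs.
  apply: (ymor_cls_push (s := 0)); exists (inl_ (dsum (mid c1) (mid c2))); split.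
    by rewrite /= pair_comp pb_infE (ses0 (pb_ses pb)) /pair_ compm0 addr0.
  by rewrite comp1m /= copair_inl.
have : push (j : hom K2 K) (cls (t := 1) c2) = pull (- idm L) (cls (t := 1) cs).
  apply: (ymor_cls (s := 0)); exists (inr_ (dsum (mid c1) (mid c2))); split.
    by rewrite /= pair_comp [pb_map _ ∘ _]j1 [pb_def _ ∘ _]j2 /pair_ compm0 add0r.
  by rewrite compNl comp1m /= copair_inr.
rewrite push_Nl => ->; apply: (addIr (pull (- idm L) (cls (t := 1) cs))).
by rewrite addNr -[X in X + _]pull1 -pull_addl subrr pull_0l.
Qed.

(** * Unit extensions and the classes they annihilate *)

(** Inversion principle for [unit_ext]. In length zero it is stated in Leibniz form, which avoids an
    equality between the objects [X] and [N]. *)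
Definition unit_shape N t : forall X, extension t N X -> Prop :=
  match t return forall X, extension t N X -> Prop with
  | 0 => fun X f => forall Q : (forall X, hom N X -> Prop), Q N (idm N) -> Q X f
  | s.+1 => fun X e => all_mid (nproj n) (e : yseq s N X)
  end.

Lemma unit_extE t N X (d : extension t N X) : unit_ext n d -> unit_shape d.
Proof. by case. Qed.

Lemma unit_ext0_inv N X (f : extension 0 N X) (Q : forall X, hom N X -> Prop) :
  unit_ext n f -> Q N (idm N) -> Q X f.
Proof. by move/unit_extE; exact. Qed.

Lemma unit_extS_inv t N X (d : extension t.+1 N X) : unit_ext n d ->
  exists L (c : conflation L X) (d' : extension t N L),
    [/\ nproj n (mid c), unit_ext n d' & cls d = mul1 (cls (t := 1) c) (cls d')].
Proof.
move/unit_extE; case: t d => [|t] d.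
  move=> hd; exists N, d, (idm N); split=> //; first exact: unit_ext0.
  by rewrite /mul1 (pull1 (t := 1)).
case: d => L [c e] [/= h1 h2]; exists L, c, e.
split; [exact: h1|exact: unit_extS|exact/esym/(mul1E c (e : extension t.+1 N L))].
Qed.

Lemma unit_ext_mul1 t N L X (c : conflation L X) (d : extension t N L) :
  nproj n (mid c) -> unit_ext n d ->
  exists d' : extension t.+1 N X, unit_ext n d' /\ cls d' = mul1 (cls (t := 1) c) (cls d).
Proof.
move=> hc /unit_extE hd; case: t d hd => [|t] d hd; last first.
  exists (splice c d : yseq t.+1 N X); split; last by rewrite (mul1E c d).
  exact: (@unit_extS _ _ _ _ t.+1).
move: X c hc; apply: (hd (fun L f => forall X (c : conflation L X), nproj n (mid c) ->
    exists d' : extension 1 N X, unit_ext n d' /\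
      cls d' = mul1 (cls (t := 1) c) (f : Ext 0 N L))) => X c hc.
(* The witness is [c] itself rather than [conf_pull (idm N) c], so that [hc] applies to its middle
   term directly. *)
exists (c : conflation N X); split.
  exact: (@unit_extS _ _ _ _ 0).
by rewrite /mul1 (pull1 (t := 1)).
Qed.

(* Multiplication on the left by a conflation with [n]-projective middle term is
   injective in degrees [> n], so [x] may be replaced by a multiple of large degree. *)
Lemma mulseq_annihilated L (H : forall s T, yseq s L T -> Prop) :
  (forall s T (x : yseq s L T), (n <= s)%N -> H s T x -> cls (t := s.+1) x = 0) ->
  (forall s T T' (k : conflation T T') (x : yseq s L T), H s T x -> H s.+1 T' (splice k x)) ->
  forall s T (x : yseq s L T) t M (y : Ext t M L),
    H s T x -> (n <= s + t)%N -> mulseq x y = 0.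
Proof.
move=> H0 HS s T x t M y Hx nst.
(* [m] bounds the number of conflations still to be spliced on the left before the degree of [x]
   exceeds [n]. *)
have [m nsm] : exists m, (n <= s + m)%N by exists n; exact: leq_addl.
elim: m => [|m IH] in s T x nsm Hx nst *.
  by apply/mulseq_eq0/H0 => //; rewrite addn0 in nsm.
have [K [k hk]] := nproj_deflation T.
have: mulseq (splice k x) y = 0.
  by apply: IH; [rewrite addSnnS|exact: HS|exact: leqW].
move=> /(mul1_cls_exact (t := (s + t).+1))[z zE]; apply: (eq_trans zE).
by rewrite [z]nproj_injective ?push_0r.
Qed.

(** Peel off the leftmost conflation [c] of [d]: by induction [x c = 0], so [x] is the restriction
    of a class on [mid c], which vanishes because its degree exceeds [n]. *)
Lemma unit_mulseq_eq0 t N X (d : extension t N X) s T (x : yseq s X T) :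
  unit_ext n d -> (n <= s)%N -> mulseq x (cls d) = 0 -> cls (t := s.+1) x = 0.
Proof.
elim: t => [|t IH] in X d s T x *.
  move=> hd; move: s T x.
  apply: (unit_ext0_inv (Q := fun X f => forall s T (x : yseq s X T), (n <= s)%N ->
    mulseq x (f : Ext 0 N X) = 0 -> cls (t := s.+1) x = 0) hd) => s T x _.
  exact/homog_eq0/mulseq_idm.
move=> /unit_extS_inv[L [c [d' [hc hd' ->]]]] ns.
move=> /(homog_eq0 (mulseq_rsplice _ _ _))/(IH _ _ _ _ _ hd' (leqW ns)).
rewrite -rmulE => /rmul_cls_exact[z ->].
by rewrite [z]hc // pull_0r.
Qed.

Lemma unit_mul1_eq0 N X (d : extension n N X) T (x : Ext 1 X T) M (g : Ext n M X) :
  unit_ext n d -> mul1 x (cls d) = 0 -> mul1 x g = 0.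
Proof.
move=> hd; have [c <-] := cls_surj x => E.
apply: (@mulseq_annihilated X (fun s T x => mulseq x (cls d) = 0) _ _ 0 T c n M g) => //.
- by move=> s T' y ns; exact: unit_mulseq_eq0.
- move=> s T1 T2 k y /(congr1 (mul1 (cls (t := 1) k))) ky; exact: (etrans ky (mul1_0r _ _ _)).
Qed.

Lemma inP_mul1_eq0 X T (x : Ext 1 X T) M (g : Ext n M X) : inP g -> mul1 x g = 0.
Proof.
move=> /asboolP[P [f [b [hP ->]]]]; rewrite -mul1_pull.
have [c <-] := cls_surj (pull f x).
apply: (@mulseq_annihilated P (fun s T x => True) _ _ 0 T c n M b) => //.
by move=> s T' y ns _; apply: hP.
Qed.

Lemma inP_mul1 X K (e : conflation X K) M (g : Ext n M X) :
  nproj n (mid e) -> mul1 (cls (t := 1) e) g = 0 -> inP g.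
Proof.
by move=> he /mul1_cls_exact[z zE]; apply/asboolP; exists (mid e), (defl e), z.
Qed.

(** * Calculus modulo the subgroup [P] *)

Lemma inPB X Y (x y : Ext n X Y) : inP x -> inP y -> inP (x - y).
Proof. exact: (nproj_sub_zmod_closed n X Y).2. Qed.

Lemma inP0 X Y : inP (0 : Ext n X Y).
Proof. exact: (nproj_sub_zmod_closed n X Y).1. Qed.

Lemma inPN X Y (x : Ext n X Y) : inP x -> inP (- x).
Proof. by move=> hx; rewrite -sub0r; apply: inPB hx; exact: inP0. Qed.

Lemma inPD X Y (x y : Ext n X Y) : inP x -> inP y -> inP (x + y).
Proof. by move=> hx hy; rewrite -[y]opprK; apply/inPB/inPN. Qed.

Lemma inP_push X Y Z (f : hom Y Z) (x : Ext n X Y) : inP x -> inP (push f x).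
Proof.
move=> /asboolP[P [h [b [hP ->]]]]; apply/asboolP; exists P, (f ∘ h), b.
by rewrite push_comp.
Qed.

(** Membership in [P] is detected by multiplying with a conflation [e] ending at [Y], and [e h]
    annihilates [d], hence also [g]. *)
Lemma unit_push_eq0 N X Y (d : extension n N X) (h : hom X Y) M (g : Ext n M X) :
  unit_ext n d -> push h (cls d) = 0 -> inP (push h g).
Proof.
move=> hd E; have [K [e he]] := nproj_deflation Y.
apply: (inP_mul1 he); rewrite -mul1_pull; apply: (unit_mul1_eq0 _ hd).
by rewrite mul1_pull E mul1_0r.
Qed.

(** Existence of [b^{-1} a g]. With [i] the inflation of [e b], [i e a d = i e b d' = 0], hence
    [i e a g = 0]; exactness then writes [e a g] as [(e b) g']. *)
Lemma angled_inverse N X X' Y (d : extension n N X) (d' : extension n N X')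
    (a : hom X Y) (b : hom X' Y) M (g : Ext n M X) :
  unit_ext n d -> push a (cls d) = push b (cls d') ->
  exists g', inP (push a g - push b g').
Proof.
move=> hd E; have [K [e he]] := nproj_deflation Y.
have bE : cls (t := 1) (conf_pull b e) = pull b (cls (t := 1) e) by rewrite (pullE (s := 0)).
pose i := infl (conf_pull b e).
have iE : push i (pull b (cls (t := 1) e)) = 0 by rewrite -bE push_infl_cls.
have [|g' gE] := @push_infl_exact _ _ _ _ _ _ (conf_pull b e) (mul1 (cls (t := 1) e) (push a g)).
  rewrite -mul1_pull mul1_push; apply: (unit_mul1_eq0 _ hd).
  by rewrite -mul1_push mul1_pull E -mul1_pull mul1_push iE mul1_0l.
exists g'; apply: (inP_mul1 he).
by rewrite mul1_Br gE bE mul1_pull subrr.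
Qed.

(** Injectivity of [b] modulo [P]: the pull-back [e b] still has an [n]-projective middle term, so
    it too detects [P]. *)
Lemma inP_push_inflation X Y (b : hom X Y) M (g : Ext n M X) :
  nproj_inflation n b -> inP (push b g) -> inP g.
Proof.
move=> hb hg; have [K [e he]] := nproj_deflation Y.
apply: (inP_mul1 (nproj_conf_pull hb he)).
rewrite -[conf_pull b e]/(ypull (s := 0) b e) -(pullE (s := 0)) mul1_pull.
exact: inP_mul1_eq0.
Qed.

(** * Factoring classes through unit extensions and comparing unit extensions *)

(** Write [y] as [c z] with [z = h d] by induction; [nproj_cover] replaces [c h] by a push-out of a
    conflation with [n]-projective middle term. *)
Lemma unit_factor t N Y (y : Ext t N Y) :
  exists X (d : extension t N X) (h : hom X Y), unit_ext n d /\ push h (cls d) = y.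
Proof.
elim: t => [|t IH] in Y y *.
  by exists N, (idm N), y; split; [exact: unit_ext0|exact: compm1].
have [L [c [z ->]]] := mul1_surj y; have [X [d [h [hd <-]]]] := IH _ z.
have [K [e [g [he gE]]]] := nproj_cover (conf_pull h c).
have [d' [hd' dE]] := unit_ext_mul1 he hd.
exists K, d', g; split=> //; rewrite dE mul1_push gE -mul1_pull.
by rewrite (pullE (s := 0)).
Qed.

(** Factor the single class with components [y] and [y'] in the direct sum. This provides a unit
    extension dominating two given ones. *)
Lemma unit_factor2 t N Y Y' (y : Ext t N Y) (y' : Ext t N Y') :
  exists X (d : extension t N X) (h : hom X Y) (h' : hom X Y'),
    [/\ unit_ext n d, push h (cls d) = y & push h' (cls d) = y'].
Proof.
have [X [d [h [hd hE]]]] := unit_factor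
  (push (K' := ex_dsum Y Y') (inl_ (dsum Y Y')) y
   + push (K' := ex_dsum Y Y') (inr_ (dsum Y Y')) y').
exists X, d, (prl (dsum Y Y') ∘ h), (prr (dsum Y Y') ∘ h); split=> //.
  rewrite -(push_comp (K' := ex_dsum Y Y')) hE push_addr !push_comp.
  by rewrite prl_inl prl_inr push1 push_0l addr0.
rewrite -(push_comp (K' := ex_dsum Y Y')) hE push_addr !push_comp.
by rewrite prr_inl prr_inr push1 push_0l add0r.
Qed.

Lemma unit_cover t N T (al : Ext t.+1 N T) :
  exists X (d : extension t N X) (x : Ext 1 X T), unit_ext n d /\ al = mul1 x (cls d).
Proof.
have [L [c [y ->]]] := mul1_surj al; have [X [d [h [hd <-]]]] := unit_factor y.
by exists X, d, (pull h (cls (t := 1) c)); rewrite mul1_pull.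
Qed.

(** Given [a], [b] with target [Y] one length lower, take [q] ending at [Y] with [n]-projective
    middle term. Schanuel compares [c] with [q a] and [c'] with [q b]; a push-out then merges the
    two targets, and [a e = b e'] gives the equality. *)
Lemma angled_pair_exists t N X X' (d : extension t N X) (d' : extension t N X') :
  unit_ext n d -> unit_ext n d' -> exists Y (a : hom X Y) (b : hom X' Y),
    [/\ nproj_inflation n a, nproj_inflation n b & push a (cls d) = push b (cls d')].
Proof.
elim: t => [|t IH] in X X' d d' *.
  move=> hd hd'.
  apply: (unit_ext0_inv (Q := fun X f => exists Y (a : hom X Y) (b : hom X' Y),
    [/\ nproj_inflation n a, nproj_inflation n b
      & push a (f : Ext 0 N X) = push b (cls d')]) hd).
  apply: (unit_ext0_inv (Q := fun X f => exists Y (a : hom N Y) (b : hom X Y),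
    [/\ nproj_inflation n a, nproj_inflation n b
      & push a (idm N : Ext 0 N N) = push b (f : Ext 0 N X)]) hd').
  by exists N, (idm N), (idm N); split=> //; exact: nproj_inflation_idm.
move=> /unit_extS_inv[L [c [e [hc he ->]]]] /unit_extS_inv[L' [c' [e' [hc' he' ->]]]].
have [Y [a [b [ha hb abE]]]] := IH _ _ _ _ he he'.
have [K [q hq]] := nproj_deflation Y.
have [Z [j1 [j2 [hj1 hj2 jE]]]] := nproj_schanuel hc (nproj_conf_pull ha hq).
have [Z' [j1' [j2' [hj1' hj2' jE']]]] := nproj_schanuel hc' (nproj_conf_pull hb hq).
have [W [k [k' [hk hk' kE]]]] := nproj_inflation_pushout hj2 hj2'.
exists W, (k ∘ j1), (k' ∘ j1'); split; try exact: nproj_inflation_comp.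
rewrite -push_comp [push j1 _]mul1_push jE -mul1_push push_comp kE.
rewrite -[RHS]push_comp [push j1' _]mul1_push jE' -mul1_push push_comp.
rewrite -[conf_pull a q]/(ypull (s := 0) a q) -[conf_pull b q]/(ypull (s := 0) b q).
by rewrite -!(pullE (s := 0)) !mul1_pull abE.
Qed.

(** * Well-definedness and additivity of the correspondence *)

Section Psi.
Variables (N Om : C) (d : extension n N Om).
Hypothesis hd : unit_ext n d.

Lemma psi_valueP M T (g : Ext n M Om) (al : Ext n.+1 N T) (be : Ext n.+1 M T) :
  psi_value d g al be <->
  exists (Om' : C) (d' : extension n N Om') (x : Ext 1 Om' T) (Y : C)
    (a : hom Om Y) (b : hom Om' Y) (g' : Ext n M Om'),
    [/\ unit_ext n d', al = mul1 x (cls d'), angled_pair d d' a b,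
        inP (push a g - push b g') & be = mul1 x g'].
Proof.
split.
  move=> [Om' [d' [c [e [Y [a [b [g' [hd' [<- fE] ab gg' ->]]]]]]]]].
  exists Om', d', (cls (t := 1) c), Y, a, b, g'; split=> //.
  by rewrite mul1E; apply/esym/yextP/rst_step.
move=> [Om' [d' [x [Y [a [b [g' [hd' -> ab gg' ->]]]]]]]].
have [c cE] := cls_surj x.
exists Om', d', c, (ymul1 c d'), Y, a, b, g'; rewrite cE; split=> //.
by rewrite -cE mul1E; split=> //; exact: (ymor_id (s := n)).
Qed.

(** Once [d3] dominates [d] and [d'], the element [b^{-1} a g] is [h' g3] modulo [P]: [b h' - a h]
    annihilates [d3], so it sends [g3] into [P], and [b] can be cancelled. *)
Lemma angled_transport Om' Om3 Y (d' : extension n N Om') (d3 : extension n N Om3)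
    (a : hom Om Y) (b : hom Om' Y) (h : hom Om3 Om) (h' : hom Om3 Om')
    M (g : Ext n M Om) (g' : Ext n M Om') (g3 : Ext n M Om3) :
  unit_ext n d3 -> push h (cls d3) = cls d -> push h' (cls d3) = cls d' ->
  angled_pair d d' a b -> inP (push a g - push b g') -> inP (g - push h g3) ->
  inP (push h' g3 - g').
Proof.
move=> hd3 hE hE' [ha hb abE] gg' g3E; apply: (inP_push_inflation hb).
have H1 : inP (push (b ∘ h' - a ∘ h) g3).
  by apply: (unit_push_eq0 _ hd3); rewrite push_Bl -!push_comp hE hE' abE subrr.
have H2 := inPB H1 (inP_push a g3E).
have := inPD H2 gg'; congr is_true; congr nproj_sub.
rewrite push_Bl !push_Br -!push_comp.
by rewrite opprB !addrA !subrK.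
Qed.

Lemma psi_value_unique M T (g : Ext n M Om) (al : Ext n.+1 N T) (be be' : Ext n.+1 M T) :
  psi_value d g al be -> psi_value d g al be' -> be = be'.
Proof.
move=> /psi_valueP[X1 [d1 [x1 [Y1 [a1 [b1 [g1 [hd1 -> ab1 gg1 ->]]]]]]]].
move=> /psi_valueP[X2 [d2 [x2 [Y2 [a2 [b2 [g2 [hd2 xE ab2 gg2 ->]]]]]]]].
have [X0 [d0 [h1 [h2 [hd0 E1 E2]]]]] := unit_factor2 (cls d1) (cls d2).
have [X3 [d3 [h [h0 [hd3 E E0]]]]] := unit_factor2 (cls d) (cls d0).
rewrite -E0 push_comp in E1; rewrite -E0 push_comp in E2.
(* [d3] dominates [d], [d1] and [d2]; the equality [1 d = h d3] lets [g] be lifted to [g3] modulo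
   [P]. *)
have [|g3 g3E] := @angled_inverse _ _ _ _ d d3 (idm Om) h M g hd; first by rewrite push1.
rewrite push1 in g3E.
have := angled_transport hd3 E E1 ab1 gg1 g3E.
move=> /(inP_mul1_eq0 x1)/eqP; rewrite mul1_Br subr_eq0 => /eqP <-.
have := angled_transport hd3 E E2 ab2 gg2 g3E.
move=> /(inP_mul1_eq0 x2)/eqP; rewrite mul1_Br subr_eq0 => /eqP <-.
(* Both products with [d3] equal the same class, so the difference of the degree-one factors
   annihilates [d3] and therefore [g3]. *)
apply/eqP; rewrite -subr_eq0 -!mul1_pull -mul1_Bl; apply/eqP.
apply: (unit_mul1_eq0 _ hd3).
by rewrite mul1_Bl !mul1_pull E1 E2 xE subrr.
Qed.

Lemma psi_value_at M T (g : Ext n M Om) Om' (d' : extension n N Om') (x : Ext 1 Om' T) :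
  unit_ext n d' -> exists be, psi_value d g (mul1 x (cls d')) be.
Proof.
move=> hd'; have [Y [a [b [ha hb abE]]]] := angled_pair_exists hd hd'.
have [g' gE] := angled_inverse g hd abE.
exists (mul1 x g'); apply/psi_valueP.
by exists Om', d', x, Y, a, b, g'; split.
Qed.

Lemma psi_value_exists M T (g : Ext n M Om) (al : Ext n.+1 N T) :
  exists be, psi_value d g al be.
Proof. by have [X [d' [x [hd' ->]]]] := unit_cover al; exact: psi_value_at. Qed.

Lemma psi_value_push M T T' (f : hom T T') (g : Ext n M Om) (al : Ext n.+1 N T)
    (be : Ext n.+1 M T) :
  psi_value d g al be -> psi_value d g (push f al) (push f be).
Proof.
move=> /psi_valueP[X [d' [x [Y [a [b [g' [hd' -> ab gg ->]]]]]]]].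
apply/psi_valueP; exists X, d', (push f x), Y, a, b, g'.
by rewrite !mul1_push.
Qed.

(** Both arguments are rewritten over one unit extension [d3], with a common [g']; additivity of
    [mul1] in its left factor remains. *)
Lemma psi_value_addr M T (g : Ext n M Om) (al al' : Ext n.+1 N T) (be be' : Ext n.+1 M T) :
  psi_value d g al be -> psi_value d g al' be' -> psi_value d g (al + al') (be + be').
Proof.
have [X1 [d1 [x1 [_ ->]]]] := unit_cover al; have [X2 [d2 [x2 [_ ->]]]] := unit_cover al'.
have [X3 [d3 [h1 [h2 [hd3 <- <-]]]]] := unit_factor2 (cls d1) (cls d2).
rewrite -!mul1_pull => H1 H2.
have [Y [a [b [ha hb abE]]]] := angled_pair_exists hd hd3.
have [g' gE] := angled_inverse g hd abE.
have val x : psi_value d g (mul1 x (cls d3)) (mul1 x g').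
  by move=> *; apply/psi_valueP; exists X3, d3, x, Y, a, b, g'; split.
rewrite (psi_value_unique H1 (val _ _)) (psi_value_unique H2 (val _ _)).
by rewrite -!mul1_addl.
Qed.

Lemma psi_value_addl M T (g g1 : Ext n M Om) (al : Ext n.+1 N T) (be be1 : Ext n.+1 M T) :
  psi_value d g al be -> psi_value d g1 al be1 -> psi_value d (g + g1) al (be + be1).
Proof.
have [X [d' [x [hd' ->]]]] := unit_cover al => H H1.
have [Y [a [b [ha hb abE]]]] := angled_pair_exists hd hd'.
have [g' gE] := angled_inverse g hd abE; have [g1' gE1] := angled_inverse g1 hd abE.
have val (u : Ext n M Om) u' : inP (push a u - push b u') ->
    psi_value d u (mul1 x (cls d')) (mul1 x u').
  by move=> E; apply/psi_valueP; exists X, d', x, Y, a, b, u'; split.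
rewrite (psi_value_unique H (val _ _ gE)) (psi_value_unique H1 (val _ _ gE1)) -mul1_addr.
by apply: val; rewrite !push_addr opprD addrACA; exact: inPD.
Qed.

Lemma psi_value_self M T (x : Ext 1 Om T) (g : Ext n M Om) :
  psi_value d g (mul1 x (cls d)) (mul1 x g).
Proof.
apply/psi_valueP; exists Om, d, x, Om, (idm Om), (idm Om), g; split=> //.
  by split=> //; exact: nproj_inflation_idm.
by rewrite subrr; exact: inP0.
Qed.

Definition psi_fun M (g : Ext n M Om) T (al : Ext n.+1 N T) : Ext n.+1 M T :=
  projT1 (cid (psi_value_exists g al)).

Lemma psi_funP M (g : Ext n M Om) T (al : Ext n.+1 N T) (be : Ext n.+1 M T) :
  psi_value d g al be <-> be = psi_fun g al.
Proof.
rewrite /psi_fun; case: cid => /= v hv; split=> [h|-> //].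
exact: psi_value_unique h hv.
Qed.

Lemma psi_fun_add M (g : Ext n M Om) T (al al' : Ext n.+1 N T) :
  psi_fun g (al + al') = psi_fun g al + psi_fun g al'.
Proof. by apply/esym/psi_funP; apply: psi_value_addr; exact/psi_funP. Qed.

Lemma psi_fun_nat M (g : Ext n M Om) T T' (f : hom T T') (al : Ext n.+1 N T) :
  psi_fun g (push f al) = push f (psi_fun g al).
Proof. by apply/esym/psi_funP; apply: psi_value_push; exact/psi_funP. Qed.

Definition psi M (g : Ext n M Om) : nat_trans n.+1 N M :=
  NatTrans (psi_fun_add g) (psi_fun_nat g).

Lemma psi_add M (g g' : Ext n M Om) : psi (g + g') = psi g + psi g'.
Proof.
apply: nat_transP => T al.
by apply/esym/psi_funP; apply: psi_value_addl; exact/psi_funP.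
Qed.

Lemma psi_opp M (g : Ext n M Om) : psi (- g) = - psi g.
Proof.
have psi0 : psi (0 : Ext n M Om) = 0.
  by apply: (addrI (psi 0)); rewrite -psi_add !addr0.
by apply: (addrI (psi g)); rewrite -psi_add !subrr.
Qed.

Lemma psi_mul1 M T (x : Ext 1 Om T) (g : Ext n M Om) :
  psi g T (mul1 x (cls d)) = mul1 x g.
Proof. by apply/esym/psi_funP; exact: psi_value_self. Qed.

(** * Kernel and image *)

Lemma psi_eq0 M (g : Ext n M Om) : psi g = 0 <-> inP g.
Proof.
split=> [E|hg].
  have [K [e he]] := nproj_deflation Om.
  by apply: (inP_mul1 he); rewrite -psi_mul1 E.
apply: nat_transP => T al; have [X [d' [x [hd' ->]]]] := unit_cover al.
have [Y [a [b [ha hb abE]]]] := angled_pair_exists hd hd'.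
(* Zero is a valid choice of [b^{-1} a g], since [a g] already lies in [P]. *)
apply/esym/psi_funP/psi_valueP; exists X, d', x, Y, a, b, 0; split=> //.
  by rewrite push_0r subr0; exact: inP_push.
by rewrite mul1_0r.
Qed.

Lemma nt_0 M (D : nat_trans n.+1 N M) T : D T 0 = 0.
Proof. by apply: (addrI (D T 0)); rewrite -nt_add !addr0. Qed.

(* Every [x] is a push-out of some [q] with [n]-projective middle term, and Schanuel's
   lemma compares [q] with [e]. *)
Lemma nat_trans_unit_eq0 M (D : nat_trans n.+1 N M) X K (d' : extension n N X)
    (e : conflation X K) :
  nproj n (mid e) -> D K (mul1 (cls (t := 1) e) (cls d')) = 0 ->
  forall T (x : Ext 1 X T), D T (mul1 x (cls d')) = 0.
Proof.
move=> he De T x; have [c <-] := cls_surj x.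
have [K' [q [f [hq <-]]]] := nproj_cover c; rewrite -mul1_push nt_nat.
suff -> : D K' (mul1 (cls (t := 1) q) (cls d')) = 0 by rewrite push_0r.
have [Z [j1 [j2 [hj1 hj2 jE]]]] := nproj_schanuel he hq.
have [|g gE] := @push_infl_exact _ _ _ _ _ _ q (D K' (mul1 (cls (t := 1) q) (cls d'))).
  by rewrite -nt_nat mul1_push push_infl_cls mul1_0l nt_0.
(* Here [j2 q g = D(j2 q d') = D(j1 e d') = 0], and [j2 q] has [n]-projective middle term; so [g]
   lies in [P] and [q g = 0]. *)
rewrite gE; apply: inP_mul1_eq0; apply: (inP_mul1 (nproj_conf_push hj2 hq)).
rewrite -[conf_push j2 q]/(ypush (s := 0) j2 q) -(pushE (s := 0)) -mul1_push -gE.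
by rewrite -nt_nat mul1_push -jE -mul1_push nt_nat De push_0r.
Qed.

(** An angled pair carries vanishing from [d] to any [d']: [(q b) d' = (q a) d], where [D] is zero,
    and [q b] has [n]-projective middle term. *)
Lemma nat_trans_eq0 M (D : nat_trans n.+1 N M) K (e : conflation Om K) :
  nproj n (mid e) -> D K (mul1 (cls (t := 1) e) (cls d)) = 0 -> D = 0.
Proof.
move=> he De; apply: nat_transP => T al.
have [X [d' [x [hd' ->]]]] := unit_cover al.
have [Y [a [b [ha hb abE]]]] := angled_pair_exists hd hd'.
have [K' [q hq]] := nproj_deflation Y.
apply: (nat_trans_unit_eq0 (nproj_conf_pull hb hq)).
rewrite -[conf_pull b q]/(ypull (s := 0) b q) -(pullE (s := 0)) mul1_pull -abE -mul1_pull.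
exact: nat_trans_unit_eq0 he De _ _.
Qed.

Lemma psi_surj M (F : nat_trans n.+1 N M) : exists g, psi g = F.
Proof.
have [K [e he]] := nproj_deflation Om.
have [|g gE] := @push_infl_exact _ _ _ _ _ _ e (F K (mul1 (cls (t := 1) e) (cls d))).
  by rewrite -nt_nat mul1_push push_infl_cls mul1_0l nt_0.
exists g; apply/eqP; rewrite -subr_eq0; apply/eqP; apply: (nat_trans_eq0 he).
have -> : (psi g - F) K (mul1 (cls (t := 1) e) (cls d)) =
  psi g K (mul1 (cls (t := 1) e) (cls d)) - F K (mul1 (cls (t := 1) e) (cls d)) by [].
by rewrite psi_mul1 gE subrr.
Qed.

End Psi.
End FrobeniusTheory.

(** * Passage to the quotient by [P] *)

Theorem theorem4p10 (A : abelian) (C : ext_closed A) (n : nat) (M N Om : C)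
    (d : extension n N Om) (hC : nFrobenius C n) (hd : unit_ext n d) :
  exists Psi : Ext n M Om -> nat_trans n.+1 N M,
    (forall (g : Ext n M Om) (T : C) (al : Ext n.+1 N T) (be : Ext n.+1 M T),
       psi_value d g al be <-> be = Psi g T al) /\
    exists Phi : {additive ExtP n M Om -> nat_trans n.+1 N M},
      (forall g : Ext n M Om, Phi (\pi_(ExtP n M Om) g) = Psi g) /\ bijective Phi.
Proof.
exists (psi hC hd (M := M)); split; first by move=> g T al be; exact: psi_funP.
pose phi (u : ExtP n M Om) := psi hC hd (repr u).
have piE (x y : Ext n M Om) :
    \pi_(ExtP n M Om) x = \pi_(ExtP n M Om) y <-> nproj_sub (x - y).
  by split=> [/eqP|h]; [|apply/eqP]; rewrite -Quotient.idealrBE.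
have phiE g : phi (\pi_(ExtP n M Om) g) = psi hC hd g.
  apply/eqP; rewrite -subr_eq0 -psi_opp -psi_add; apply/eqP/psi_eq0/piE.
  by rewrite reprK.
have phiB : zmod_morphism phi.
  elim/quotW=> x; elim/quotW=> y; rewrite -[_ - _]pi_is_zmod_morphism.
  by rewrite !phiE psi_add psi_opp.
pose Phi : {additive ExtP n M Om -> nat_trans n.+1 N M} :=
  HB.pack phi (GRing.isZmodMorphism.Build _ _ phi phiB).
exists Phi; split=> //.
(* The inverse takes the class of a chosen preimage; two preimages differ by an element of the
   kernel, which is [P]. *)
exists (fun F => \pi_(ExtP n M Om) (projT1 (cid (psi_surj hC hd F)))).
  elim/quotW=> g; rewrite [Phi _]phiE; case: cid => /= g' gE.
  by apply/piE/(psi_eq0 hC hd); rewrite psi_add psi_opp gE subrr.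
by move=> F; rewrite [LHS]phiE; case: cid.
Qed.
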